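(* Let $N\ge 1$ be an integer, $A>-1/2$, $B\in(-A,A+1)$, and let $C$ be a real number such that either (Case 1) $C<-A-N+1$, or (Case 2) $C>A+N$. Let $\mathcal T=(-(A+B),\infty)$ in Case 1 and $\mathcal T=(-(A+B),C-A-N)$ in Case 2. Let $(\xi_t)_{t\in\mathcal T}$ be the Markov chain with parameters $N,A,B,C$ described in the context and let $Y_t=(A+t+\xi_t)(A+\xi_t)$ for $t\in\mathcal T$. In Case 1, $(Y_t)_{t\in\mathcal T}$ can be transformed (in the sense of the context) into a quadratic harness $(Z_t)$ on $\mathcal T'=(0,1)$ with parameters $$\eta=-\frac{A(B+C+N)+C(B+C)+N(N-B)}{\sqrt{N(A+C)(B+C)(A-B+N)(N-1-B-C)}},$$ $$\theta=-\frac{A(B+C+N)-B(B+C-N)+2CN}{\sqrt{N(A+C)(B+C)(A-B+N)(N-1-B-C)}},$$ $$\sigma=\tau=\frac{1}{N-1-B-C},\qquad \gamma=1+2\sqrt{\sigma\tau}=\frac{B+C-N-1}{B+C-N+1}.$$ In Case 2, $(Y_t)_{t\in\mathcal T}$ can be transformed into a quadratic harness $(Z_t)$ on $\mathcal T'=(0,\infty)$ with parameters $$\eta=-\frac{A(B+C+N)+C(B+C)+N(N-B)}{\sqrt{N(A+C)(B+C)(A-B+N)(B+C-N+1)}},$$ $$\theta=\frac{A(B+C+N)-B(B+C-N)+2CN}{\sqrt{N(A+C)(B+C)(A-B+N)(B+C-N+1)}},$$ $$\sigma=\tau=\frac{1}{B+C-N+1},\qquad \gamma=1-2\sqrt{\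sigma\tau}=\frac{B+C-N-1}{B+C-N+1}.$$
   Context: Pochhammer symbol: $(\alpha)_0=1$, $(\alpha)_k=\alpha(\alpha+1)\cdots(\alpha+k-1)$. Weights: for integers $0\le k\le N$, $$p_{k,N}(a,b,c)=C_N(a,b,c)\,\frac{(2a)_k(a+1)_k(a+b)_k(a+c)_k(-N)_k}{k!\,(a)_k(a-b+1)_k(a-c+1)_k(2a+N+1)_k},\qquad C_N(a,b,c)=\frac{(a-b+1)_N(a-c+1)_N}{(2a+1)_N(-b-c+1)_N},$$ where the factor $(2a)_k(a+1)_k/(a)_k$ is read in its simplified form: $1$ if $k=0$, and $2(2a+1)_{k-1}(a+k)$ if $k\ge1$ (so that $a=0$ is allowed). Markov chain: $(\xi_t)_{t\in\mathcal T}$ is the Markov chain on $\{0,\dots,N\}$ with univariate laws $\Pr(\xi_t=j)=p_{j,N}(A+\tfrac t2,B+\tfrac t2,C-\tfrac t2)$ and, for $s<t$ in $\mathcal T$, transition probabilities $$\Pr(\xi_t=n\mid\xi_s=k)=p_{n-k,N-k}\left(A+\tfrac t2+k,\,-A-s+\tfrac t2-k,\,C-\tfrac t2\right),\quad 0\le k\le n\le N,$$ and $0$ if $n<k$. Quadratic harness: let $T\subset(0,\infty)$ be an open interval. A square-integrable process $(Z_t)_{t\in T}$ is a quadratic harness on $T$ with parameters $(\eta,\theta,\sigma,\tau,\gamma)$ if, with $\mathcal F_{s,u}=\sigma(Z_r:r\in T,\ r\le s\text{ or }r\ge u)$, $\mathcal F_{\le s}=\sigma(Z_r:r\in T, r\le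 s)$, $\mathcal F_{\ge u}=\sigma(Z_r: r\in T, r\ge u)$: (i) $E(Z_t)=0$ and $E(Z_sZ_t)=\min\{s,t\}$ for $s,t\in T$; (ii) for $s<t<u$ in $T$, $E(Z_t\mid\mathcal F_{s,u})=\frac{u-t}{u-s}Z_s+\frac{t-s}{u-s}Z_u$; (iii) for $s<t<u$ in $T$, $$\mathrm{Var}(Z_t\mid\mathcal F_{s,u})=\frac{(u-t)(t-s)}{u(1+\sigma s)+\tau-\gamma s}\Big(1+\eta\tfrac{uZ_s-sZ_u}{u-s}+\theta\tfrac{Z_u-Z_s}{u-s}+\sigma\tfrac{(uZ_s-sZ_u)^2}{(u-s)^2}+\tau\tfrac{(Z_u-Z_s)^2}{(u-s)^2}-(1-\gamma)\tfrac{(Z_u-Z_s)(uZ_s-sZ_u)}{(u-s)^2}\Big);$$ (iv) for $s\le t\le u$ in $T$: $E(Z_t\mid\mathcal F_{\ge u})=\frac tuZ_u$, $E(Z_t\mid\mathcal F_{\le s})=Z_s$, $\mathrm{Var}(Z_t\mid\mathcal F_{\le s})=\frac{t-s}{1+\sigma s}(\sigma Z_s^2+\eta Z_s+1)$, $\mathrm{Var}(Z_t\mid\mathcal F_{\ge u})=\frac{t(u-t)}{u+\tau}\left(\tau\frac{Z_u^2}{u^2}+\theta\frac{Z_u}{u}+1\right)$. ''$(Y_t)_{t\in\mathcal T}$ can be transformed into a quadratic harness $(Z_t)$ on $\mathcal T'$'' means: there are affine functions $\ell,m:\mathbb R\to\mathbb R$ such that $m$ does not vanish on $\mathcal T'$,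 $t\mapsto \ell(t)/m(t)$ is a bijection of $\mathcal T'$ onto $\mathcal T$, and, with $X_t=Y_t-E(Y_t)$, the process $Z_t=m(t)X_{\ell(t)/m(t)}$, $t\in\mathcal T'$, is a quadratic harness on $\mathcal T'$.
   Formalization: In Case 1 with N = 1 the formal theorem also assumes B + C < 0; for N = 1 and 0 ≤ B + C < 1 the printed σ is undefined or negative and the stated equality 1 + 2√(στ) = (B+C−N−1)/(B+C−N+1) fails. *)

(* Defs.v *)
From HB Require Import structures.
From mathcomp Require Import all_boot all_order all_algebra.
From mathcomp Require Import all_classical all_reals all_analysis.

Set Implicit Arguments.
Unset Strict Implicit.
Unset Printing Implicit Defensive.

Import Order.TTheory GRing.Theory Num.Theory.
Import numFieldNormedType.Exports.

Local Open Scope classical_set_scope.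
Local Open Scope ring_scope.

Definition pochhammer {R : realType} (x : R) (k : nat) : R :=
  \prod_(i < k) (x + i%:R).

(* (2a)_k (a+1)_k / (a)_k with the factors a, a+1, ..., a+k-1 cancelled, so
   that a = 0 is allowed. *)
Definition lead_factor {R : realType} (a : R) (k : nat) : R :=
  if k is j.+1 then 2 * pochhammer (2 * a + 1) j * (a + k%:R) else 1.

Definition weight_const {R : realType} (N : nat) (a b c : R) : R :=
  pochhammer (a - b + 1) N * pochhammer (a - c + 1) N
  / (pochhammer (2 * a + 1) N * pochhammer (- b - c + 1) N).

Definition weight {R : realType} (k N : nat) (a b c : R) : R :=
  weight_const N a b c
  * (lead_factor a k * pochhammer (a + b) k * pochhammer (a + c) k
     * pochhammer (- N%:R) k)
  / (k`!%:R * pochhammer (a - b + 1) k * pochhammer (a - c + 1) k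
     * pochhammer (2 * a + N%:R + 1) k).

Section conditioning.
Context {R : realType} {d : measure_display} {T : measurableType d}.
Variable P : probability T R.

Definition cond_prob (E F : set T) : R := fine (P (E `&` F)) / fine (P F).

(* sigma(Z_r : r in I) *)
Definition process_sigma {d' : measure_display} {S : measurableType d'}
    (Z : R -> T -> S) (I : set R) : set (set T) :=
  <<s \bigcup_(r in I) g_sigma_algebra_preimage (Z r) >>.

(* Y is a version of E(X | G) *)
Definition is_cond_exp (G : set (set T)) (X Y : T -> R) : Prop :=
  [/\ g_sigma_algebra_preimage Y `<=` G,
      P.-integrable setT (EFin \o Y) &
      forall E, G E ->
        (\int[P]_(w in E) (Y w)%:E = \int[P]_(w in E) (X w)%:E)%E].

(* V is a version of Var(X | G) = E((X - E(X | G))^2 | G) *)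
Definition is_cond_var (G : set (set T)) (X V : T -> R) : Prop :=
  exists2 M : T -> R, is_cond_exp G X M &
    is_cond_exp G (fun w => (X w - M w) ^+ 2) V.

End conditioning.

Section markov.
Context {R : realType} {d : measure_display} {T : measurableType d}.
Variable P : probability T R.

Record racah_chain (N : nat) (A B C : R) (D : set R) (xi : R -> T -> nat)
    : Prop := RacahChain {
  chain_measurable : forall t, D t -> measurable_fun setT (xi t) ;
  chain_states : forall t, D t -> forall w, (xi t w <= N)%N ;
  (* Markov property: P(xi_t = n | F_{<= s}) = P(xi_t = n | xi_s) *)
  chain_markov : forall s t, D s -> D t -> s < t -> forall n : nat,
    is_cond_exp P (process_sigma xi [set r | D r /\ r <= s])
      (\1_[set w | xi t w = n])
      (fun w => cond_prob P [set v | xi t v = n] [set v | xi s v = xi s w]) ;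
  chain_law : forall t, D t -> forall j : nat, (j <= N)%N ->
    P [set w | xi t w = j]
      = (weight j N (A + t / 2) (B + t / 2) (C - t / 2))%:E ;
  chain_transition : forall s t, D s -> D t -> s < t ->
    forall k n : nat, (k <= N)%N -> (n <= N)%N ->
    P [set w | xi s w = k] != 0%E ->
    cond_prob P [set w | xi t w = n] [set w | xi s w = k]
      = if (k <= n)%N then
          weight (n - k) (N - k) (A + t / 2 + k%:R)
            (- A - s + t / 2 - k%:R) (C - t / 2)
        else 0 }.

End markov.

Section harness.
Context {R : realType} {d : measure_display} {T : measurableType d}.
Variable P : probability T R.

Record quadratic_harness (D : set R) (Z : R -> T -> R)
    (eta theta sigma tau gamma : R) : Prop := QuadraticHarness {
  harness_domain : [/\ open D, is_interval D & D `<=` [set t | 0 < t]] ;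
  harness_L2 : forall t, D t -> Z t \in Lfun P 2%:E ;
  harness_mean : forall t, D t -> ('E_P[Z t] = 0)%E ;
  harness_cov : forall s t, D s -> D t ->
    ('E_P[fun w => (Z s w * Z t w)%R] = (Num.min s t)%:E)%E ;
  harness_cond_exp : forall s t u, D s -> D t -> D u -> s < t -> t < u ->
    is_cond_exp P (process_sigma Z [set r | D r /\ (r <= s \/ u <= r)]) (Z t)
      (fun w => (u - t) / (u - s) * Z s w + (t - s) / (u - s) * Z u w) ;
  harness_cond_var : forall s t u, D s -> D t -> D u -> s < t -> t < u ->
    is_cond_var P (process_sigma Z [set r | D r /\ (r <= s \/ u <= r)]) (Z t)
      (fun w => (u - t) * (t - s)
        / (u * (1 + sigma * s) + tau - gamma * s)
        * (1 + eta * ((u * Z s w - s * Z u w) / (u - s))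
             + theta * ((Z u w - Z s w) / (u - s))
             + sigma * ((u * Z s w - s * Z u w) ^+ 2 / (u - s) ^+ 2)
             + tau * ((Z u w - Z s w) ^+ 2 / (u - s) ^+ 2)
             - (1 - gamma)
               * ((Z u w - Z s w) * (u * Z s w - s * Z u w)
                  / (u - s) ^+ 2))) ;
  harness_future_exp : forall t u, D t -> D u -> t <= u ->
    is_cond_exp P (process_sigma Z [set r | D r /\ u <= r]) (Z t)
      (fun w => t / u * Z u w) ;
  harness_past_exp : forall s t, D s -> D t -> s <= t ->
    is_cond_exp P (process_sigma Z [set r | D r /\ r <= s]) (Z t) (Z s) ;
  harness_past_var : forall s t, D s -> D t -> s <= t ->
    is_cond_var P (process_sigma Z [set r | D r /\ r <= s]) (Z t)
      (fun w => (t - s) / (1 + sigma * s)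
                * (sigma * Z s w ^+ 2 + eta * Z s w + 1)) ;
  harness_future_var : forall t u, D t -> D u -> t <= u ->
    is_cond_var P (process_sigma Z [set r | D r /\ u <= r]) (Z t)
      (fun w => t * (u - t) / (u + tau)
                * (tau * (Z u w ^+ 2 / u ^+ 2) + theta * (Z u w / u) + 1)) }.

Definition affine (f : R -> R) : Prop :=
  exists p q : R, forall t, f t = p * t + q.

Definition transformable_to_harness (D : set R) (Y : R -> T -> R)
    (D' : set R) (eta theta sigma tau gamma : R) : Prop :=
  exists l m : R -> R,
    [/\ affine l, affine m, (forall t, D' t -> m t != 0),
        set_bij D' D (fun t => l t / m t) &
        quadratic_harness D'
          (fun t w => let r := l t / m t in
                      m t * (Y r w - fine ('E_P[Y r])%E))
          eta theta sigma tau gamma].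

End harness.

Definition harness_process {R : realType} {T : Type} (A : R)
    (xi : R -> T -> nat) (t : R) (w : T) : R :=
  (A + t + (xi t w)%:R) * (A + (xi t w)%:R).

(* Main.v *)
Require Import Defs.
From HB Require Import structures.
From mathcomp Require Import all_boot all_order all_algebra.
From mathcomp Require Import all_classical all_reals all_analysis.
From mathcomp Require Import measurable_realfun.
From mathcomp Require Import zify ring lra.

(** The chain lives on the quadratic lattice: at time [t] the process is
    [Y_t = (x + t) x] with [x = A + xi_t], that is [y ^+ 2 - t ^+ 2 / 4] in the
    node [y = x + t / 2] of the weights.  Everything rests on one family of
    kernels, the weights read as the law at time [t] of a chain which starts at
    a lattice point at time [s] and is absorbed at another lattice point at a
    later time [u] ([kernel], [state_kernel]).  The transitions of the chain are
    the kernels absorbed at [N] at time [t1 = C - A - N]; its one-dimensional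
    laws are those started at [0] at time [s0 = - (A + B)]; and, because the
    Pochhammer symbols of two successive transitions recombine
    ([kernel_bridge]), the law of the state at time [t] given the states at times
    [s] and [u] is again one of these kernels.  Forward, backward and two-sided
    conditioning are thus three instances of a single computation.

    That computation is the mean and the variance of [Y_t] under a kernel.  The
    weights satisfy a discrete Pearson equation, and summation by parts against
    it ([weight_abel_sum]) expresses the second and the fourth moment of the
    node in terms of the total mass, which is one because the kernel is a
    conditional law.  Writing [Y_s] and [Y_u] for the two end values, the mean
    of [Y_t] is the linear interpolation between them, and its variance is
    [(t - s) (u - t) / (u - s + 1)] times
    [((Y_u - Y_s) / (u - s)) ^+ 2 + (s Y_u - u Y_s) / (u - s)]
    ([state_kernel_mean], [state_kernel_variance]).  So [Y] itself has linear
    regressions and quadratic conditional variances.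

    A Moebius change of time which sends [0] to [s0] and [eps] times infinity to
    [t1] turns [Y], centred and multiplied by the denominator of the Moebius
    map, into a process with covariance [min (s, t)].  Here [eps = -1] when [t1]
    lies before [s0], so that the chain lives up to time infinity, the image of
    [1]; and [eps = 1] when it lies after [s0].  The quadratic form above is
    carried to the one of the harness property ([rescale_bridge_variance]), and
    its coefficients are the asserted parameters in both cases at once.

    The passage from sums over states to conditional expectations given
    uncountably many variables uses only that the state space is finite.  The
    Markov property extends from cylinders to generated sigma-algebras by
    Dynkin's argument ([pr_eq_g_sigma_algebra], [past_future_independent]), and
    yields the three conditional laws [past_law], [future_law] and [bridge_law];
    a conditional expectation is then a finite sum ([is_cond_exp_kernel]). *)

Import Order.TTheory GRing.Theory Num.Theory.
Import numFieldNormedType.Exports.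

Local Open Scope classical_set_scope.
Local Open Scope ring_scope.

Set Implicit Arguments.
Unset Strict Implicit.
Unset Printing Implicit Defensive.

(** * Pochhammer symbols and weights *)

Section pochhammer_theory.
Variable R : realType.
Implicit Types (x y a b c : R) (i j k l m n : nat).

Lemma pochhammer0 x : pochhammer x 0 = 1.
Proof. exact: big_ord0. Qed.

Lemma pochhammerS x k : pochhammer x k.+1 = pochhammer x k * (x + k%:R).
Proof. exact: big_ord_recr. Qed.

Lemma pochhammerD x k l :
  pochhammer x (k + l) = pochhammer x k * pochhammer (x + k%:R) l.
Proof.
elim: l => [|l IH]; first by rewrite addn0 pochhammer0 mulr1.
by rewrite addnS !pochhammerS IH -mulrA natrD addrA.
Qed.

Lemma pochhammer_neq0 x k :
  (forall i, (i < k)%N -> x + i%:R != 0) -> pochhammer x k != 0.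
Proof. by move=> x_neq0; apply/prodf_neq0 => i _; apply: x_neq0. Qed.

Lemma pochhammer_gt0 x k : 0 < x -> 0 < pochhammer x k.
Proof. by move=> x_gt0; apply: prodr_gt0 => i _; rewrite ltr_wpDr. Qed.

Lemma pochhammer_reflect x k :
  pochhammer (1 - x - k%:R) k = (- 1) ^+ k * pochhammer x k.
Proof.
rewrite /pochhammer (reindex_inj rev_ord_inj) /= -[in (- 1) ^+ k](card_ord k).
rewrite -prodr_const -big_split /=; apply: eq_bigr => i _.
by rewrite natrB //= -natr1; ring.
Qed.

Lemma pochhammer_negn n i :
  pochhammer (- (n + i)%:R : R) n * i`!%:R = (- 1) ^+ n * (n + i)`!%:R.
Proof.
elim: n => [|n IH]; first by rewrite pochhammer0 expr0.
have shift j : - (n.+1 + i)%:R + j.+1%:R = - (n + i)%:R + j%:R :> R.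
  by rewrite addSn -[in LHS]natr1 -[j.+1%:R]natr1; ring.
rewrite /pochhammer big_ord_recl /= addr0.
under eq_bigr => j _ do rewrite shift.
by rewrite -/(pochhammer _ n) -mulrA IH addSn factS natrM exprS; ring.
Qed.

Lemma lead_factorS a k :
  lead_factor a k.+1 = 2 * pochhammer (2 * a + 1) k * (a + k.+1%:R).
Proof. by []. Qed.

(** Unless [n + i = 0], both sides are [(2 a + 1)_(2 n + i - 1)] times
    [2 a + 2 n + 2 i]; stated as a product, the identity also covers the values
    of [a] at which a cancelled factor would vanish. *)
Lemma lead_factorD a n i :
  lead_factor a (n + i) * pochhammer (2 * a + (n + i)%:R) n
  = lead_factor (a + n%:R) i * pochhammer (2 * a + 1) (n + n).
Proof.
have shift k : 2 * a + k.+1%:R = 2 * a + 1 + k%:R by rewrite -natr1; ring.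
case: i => [|i].
  case: n => [|n]; first by rewrite !pochhammer0.
  rewrite addn0 lead_factorS shift [in RHS]addnS [in RHS]pochhammerS.
  rewrite [in RHS]addSnnS pochhammerD.
  by rewrite /= natrD -!natr1; ring.
rewrite addnS !lead_factorS shift.
rewrite (_ : _ * _ * _ = 2 * (a + (n + i).+1%:R) * (pochhammer (2 * a + 1) (n + i)
  * pochhammer (2 * a + 1 + (n + i)%:R) n)); last by ring.
rewrite -pochhammerD (addnAC n i n) pochhammerD.
have -> : 2 * (a + n%:R) + 1 = 2 * a + 1 + (n + n)%:R by rewrite natrD; ring.
by rewrite -!natr1 !natrD; ring.
Qed.

(** Trading the quotients of the definition for products of the trailing
    factors leaves only [(2 a + 1)_(2 j + l)] and [(1 - b - c)_(j + l)] next to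
    the factorial in the denominator, which is what makes products of weights
    comparable. *)
Lemma weight_closed a b c j l :
  pochhammer (a - b + 1) j != 0 -> pochhammer (a - c + 1) j != 0 ->
  weight j (j + l) a b c =
  lead_factor a j * pochhammer (a + b) j * pochhammer (a + c) j
  * pochhammer (- (j + l)%:R) j / j`!%:R
  * (pochhammer (a - b + 1 + j%:R) l * pochhammer (a - c + 1 + j%:R) l
     / (pochhammer (2 * a + 1) (j + l + j)
        * pochhammer (- b - c + 1) (j + l))).
Proof.
move=> nzb nzc; rewrite /weight /weight_const.
rewrite (pochhammerD (a - b + 1)) (pochhammerD (a - c + 1)).
rewrite (pochhammerD (2 * a + 1) (j + l)).
have -> : 2 * a + 1 + (j + l)%:R = 2 * a + (j + l)%:R + 1 by ring.
rewrite !invfM -!mulrA.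
set ib := (pochhammer (a - b + 1) j)^-1.
set ic := (pochhammer (a - c + 1) j)^-1.
set u := pochhammer (a - b + 1) j; set v := pochhammer (a - c + 1) j.
have ub : u * ib = 1 by rewrite divff.
have vc : v * ic = 1 by rewrite divff.
transitivity ((u * ib) * (v * ic) * (
  pochhammer (a - b + 1 + j%:R) l * pochhammer (a - c + 1 + j%:R) l *
  (pochhammer (2 * a + 1) (j + l))^-1 * (pochhammer (- b - c + 1) (j + l))^-1
  * lead_factor a j * pochhammer (a + b) j * pochhammer (a + c) j
  * pochhammer (- (j + l)%:R) j * j`!%:R^-1 *
  (pochhammer (2 * a + (j + l)%:R + 1) j)^-1)); first by ring.
by rewrite ub vc; ring.
Qed.

(** The transition probability from the point [x] at time [s] to the point
    [x + j] at time [t], on the lattice [x, x + 1, ..., x + M].  The parameter [C]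
    encodes the time [C - (x + M)] of absorption at the far end [x + M]; this
    end is the same for all the transitions of the chain, and so is [C]. *)
Definition kernel (C x s t : R) (j M : nat) : R :=
  weight j M (x + t / 2) (- x - s + t / 2) (C - t / 2).

Lemma kernel_closed C x s t j l :
  pochhammer (2 * x + s + 1) j != 0 -> pochhammer (x - C + t + 1) j != 0 ->
  kernel C x s t j (j + l) =
  lead_factor (x + t / 2) j * pochhammer (t - s) j * pochhammer (x + C) j
  * pochhammer (- (j + l)%:R) j / j`!%:R
  * (pochhammer (2 * x + s + 1 + j%:R) l * pochhammer (x - C + t + 1 + j%:R) l
     / (pochhammer (2 * x + t + 1) (j + l + j)
        * pochhammer (x - C + s + 1) (j + l))).
Proof.
have eb : x + t / 2 - (- x - s + t / 2) + 1 = 2 * x + s + 1 by field.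
have ec : x + t / 2 - (C - t / 2) + 1 = x - C + t + 1 by field.
have ep : x + t / 2 + (- x - s + t / 2) = t - s by field.
have eC : x + t / 2 + (C - t / 2) = x + C by field.
have ea : 2 * (x + t / 2) + 1 = 2 * x + t + 1 by field.
have ed : - (- x - s + t / 2) - (C - t / 2) + 1 = x - C + s + 1 by field.
move=> nzb nzc; rewrite /kernel weight_closed ?eb ?ec //.
by rewrite ep eC ea ed.
Qed.

End pochhammer_theory.

(** * Products of transition probabilities *)

Section bridge.
Variable R : realType.
Implicit Types (x s t u C : R) (i j k l m n : nat).

(** Every factor of two successive transition probabilities that involves the
    parameter [C] recombines, through [(y)_(k + l) = (y)_k (y + k)_l], into the
    transition probability over the whole time span.  What is left is free of
    [C]: it is a transition probability of the same family, absorbed at time [u]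
    at the point reached then, whence the parameter [x + u + (n + i)]. *)
Lemma kernel_bridge C x s t u n i l :
  0 < 2 * x + s + 1 -> s < t -> t < u ->
  (forall j, (j < n + (i + l))%N -> x - C + s + 1 + j%:R != 0) ->
  (forall j, (j < n + (i + l))%N -> x - C + t + 1 + j%:R != 0) ->
  (forall j, (j < n + (i + l))%N -> x - C + u + 1 + j%:R != 0) ->
  kernel C x s t n (n + (i + l)) * kernel C (x + n%:R) t u i (i + l)
  = kernel C x s u (n + i) (n + (i + l))
    * kernel (x + u + (n + i)%:R) x s t n (n + i).
Proof.
move=> ys_gt0 st tu regs regt regu.
have yt_gt0 : 0 < 2 * x + t + 1 by lra.
have yu_gt0 : 0 < 2 * x + u + 1 by lra.
have us_neq0 k : pochhammer (u - s) k != 0.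
  by rewrite gt_eqF// pochhammer_gt0// subr_gt0 (lt_trans st).
have ut_neq0 k : pochhammer (u - t) k != 0.
  by rewrite gt_eqF// pochhammer_gt0// subr_gt0.
have pt_neq0 k m : (k + m <= n + (i + l))%N ->
    pochhammer (x - C + t + 1 + k%:R) m != 0.
  move=> km; apply: pochhammer_neq0 => j jm.
  by rewrite -addrA -natrD regt// (leq_trans _ km)// ltn_add2l.
have pu_neq0 k m : (k + m <= n + (i + l))%N ->
    pochhammer (x - C + u + 1 + k%:R) m != 0.
  move=> km; apply: pochhammer_neq0 => j jm.
  by rewrite -addrA -natrD regu// (leq_trans _ km)// ltn_add2l.
have t0 : pochhammer (x - C + t + 1) n != 0.
  by have := pt_neq0 0%N n (leq_addr _ _); rewrite addr0.
have u0 : pochhammer (x - C + u + 1) (n + i) != 0.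
  by have := pu_neq0 0%N (n + i)%N; rewrite addr0; apply; rewrite add0n addnA leq_addr.
have gt0N (y : R) k : 0 < y -> pochhammer y k != 0.
  by move=> y0; rewrite gt_eqF// pochhammer_gt0.
have e1 : 2 * (x + n%:R) + t + 1 = 2 * x + t + 1 + n%:R + n%:R by ring.
have e2 : x + n%:R - C + u + 1 = x - C + u + 1 + n%:R by ring.
have e3 : x + n%:R - C + t + 1 = x - C + t + 1 + n%:R by ring.
have e4 : 2 * (x + n%:R) + u + 1 = 2 * x + u + 1 + n%:R + n%:R by ring.
have e5 : x + n%:R + u / 2 = x + u / 2 + n%:R by ring.
have e6 : x + n%:R + C = x + C + n%:R by ring.
have e7 : x - (x + u + (n + i)%:R) + t + 1 = 1 - (u - t) - (n + i)%:R by ring.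
have e8 : x - (x + u + (n + i)%:R) + s + 1 = 1 - (u - s) - (n + i)%:R by ring.
have e9 : 1 - (u - t) - (n + i)%:R + n%:R = 1 - (u - t) - i%:R.
  by rewrite natrD; ring.
have e10 : x + (x + u + (n + i)%:R) = 2 * (x + u / 2) + (n + i)%:R by field.
have e11 : 2 * (x + u / 2) + 1 = 2 * x + u + 1 by field.
have e12 : - (n + (i + l))%:R + n%:R = - (i + l)%:R :> R by rewrite natrD; ring.
rewrite kernel_closed//; last exact: gt0N.
rewrite kernel_closed ?e1 ?e2; last 2 first.
- by apply: gt0N; rewrite ltr_wpDr// ltr_wpDr//.
- by apply: pu_neq0; rewrite leq_add2l leq_addr.
rewrite [in kernel C x s u _ _]addnA kernel_closed//; last exact: gt0N.
have s4 : pochhammer (1 - (u - t) - (n + i)%:R) n != 0.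
  apply/prodf_neq0 => j _; rewrite lt_eqF//.
  have := ltn_ord j; rewrite -(ler_nat R) -natr1 natrD => jn.
  by have := ler0n R i; lra.
rewrite kernel_closed ?e7//; last exact: gt0N.
rewrite e3 e4 e5 e6 e8 e9 e10.
rewrite !pochhammer_reflect -(addnA n i l).
rewrite (pochhammerD (2 * x + s + 1 + n%:R) i l).
rewrite (pochhammerD (x + C) n i) (pochhammerD (- (n + (i + l))%:R) n i) e12.
have -> : (n + (i + l) + n = n + i + n + l)%N by ring.
rewrite (pochhammerD (2 * x + t + 1) (n + i + n) l).
have -> : (n + (i + l) + (n + i) = n + n + (i + l + i))%N by ring.
rewrite (pochhammerD (2 * x + u + 1) (n + n)).
have gn : (n`!%:R : R) != 0 by rewrite pnatr_eq0 -lt0n fact_gt0.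
have gi : (i`!%:R : R) != 0 by rewrite pnatr_eq0 -lt0n fact_gt0.
have gni : ((n + i)`!%:R : R) != 0 by rewrite pnatr_eq0 -lt0n fact_gt0.
have neg : pochhammer (- (n + i)%:R) n = (-1) ^+ n * (n + i)`!%:R / i`!%:R :> R.
  by rewrite -pochhammer_negn mulfK.
have z1 := pt_neq0 n (i + l)%N (leqnn _).
have z2 := us_neq0 (n + i)%N.
have z3 := gt0N _ (n + i + n)%N yt_gt0.
have z4 := gt0N _ (n + n)%N yu_gt0.
have z5 : pochhammer (2 * x + u + 1 + (n + n)%:R) (i + l + i) != 0.
  by apply: gt0N; rewrite ltr_wpDr.
have z6 : pochhammer (2 * x + t + 1 + (n + i + n)%:R) l != 0.
  by apply: gt0N; rewrite ltr_wpDr.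
have z7 : (-1) ^+ n != 0 :> R by rewrite signr_eq0.
have z8 : (-1) ^+ i != 0 :> R by rewrite signr_eq0.
have z9 := pochhammer_neq0 regs.
have lead : lead_factor (x + u / 2 + n%:R) i =
    lead_factor (x + u / 2) (n + i) * pochhammer (2 * (x + u / 2) + (n + i)%:R) n
    / pochhammer (2 * x + u + 1) (n + n).
  by rewrite lead_factorD e11 mulfK.
rewrite neg lead (exprD _ n i); move: z1 z2 z3 z4 z5 z6 z9.
rewrite -!addrA -!natrD (addnA n n i) (addnAC n n i) => z1 z2 z3 z4 z5 z6 z9.
field.
by rewrite gn gi gni z1 z2 z3 z4 z5 z6 z7 z8 z9.
Qed.

End bridge.

(** * Mean and variance under a transition kernel *)

Section moments.
Variable R : realType.
Implicit Types (a b c x y s t u C : R) (i j k l m n M : nat) (f h : nat -> R).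

(** Abel summation against the discrete Pearson equation of the weights: with
    [y = a + j] the nodes, the weight at [j] times
    [(y + a) (y + b) (y + c) (y - a - M) / y], and the weight at [j + 1] times
    [(y - a) (y - b) (y - c) (y + a + M) / y] for the node [y = a + j + 1], are
    one and the same quantity [flux j].  The hypothesis on [f 0] is the equation
    for [f] at [j = 0] after cancelling [y = a], which may vanish. *)
Lemma weight_abel_sum a b c M f h :
  0 < 2 * a + 1 ->
  (forall i, (i < M)%N -> a - b + 1 + i%:R != 0) ->
  (forall i, (i < M)%N -> a - c + 1 + i%:R != 0) ->
  (forall j, (a + j%:R) * f j
     = (2 * a + j%:R) * (a + j%:R + b) * (a + j%:R + c) * (j%:R - M%:R) * h j.+1
       - j%:R * (a + j%:R - b) * (a + j%:R - c) * (2 * a + j%:R + M%:R) * h j) ->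
  f 0 = - (2 * (a + b) * (a + c) * M%:R * h 1) ->
  \sum_(j < M.+1) weight j M a b c * f j = 0.
Proof.
move=> a_gt0 nzb nzc fE f0E.
pose flux i := weight_const M a b c * (2 * pochhammer (2 * a + 1) i
  * pochhammer (a + b) i.+1 * pochhammer (a + c) i.+1
  * pochhammer (- M%:R) i.+1) / (i`!%:R * pochhammer (a - b + 1) i
  * pochhammer (a - c + 1) i * pochhammer (2 * a + M%:R + 1) i).
have partial m : (m <= M)%N ->
    \sum_(j < m.+1) weight j M a b c * f j = flux m * h m.+1.
  elim: m => [_|m IH mM].
    rewrite big_ord_recl big_ord0 addr0 f0E /flux /weight /=.
    by rewrite !pochhammerS !pochhammer0 /=; field.
  rewrite big_ord_recr /= IH ?(ltnW mM)//.
  have y_gt0 : 0 < a + m.+1%:R.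
    by have : 1 <= m.+1%:R :> R; [rewrite ler1n | lra].
  have -> : f m.+1 = ((a + m.+1%:R) * f m.+1) / (a + m.+1%:R).
    by rewrite mulrC mulKf// gt_eqF.
  rewrite fE /flux /weight lead_factorS factS natrM.
  have shift z : pochhammer z m.+2 = pochhammer z m.+1 * (z + m.+1%:R).
    exact: pochhammerS.
  rewrite !shift !(pochhammerS (a - b + 1)) !(pochhammerS (a - c + 1)).
  rewrite !(pochhammerS (2 * a + 1)) !(pochhammerS (2 * a + M%:R + 1)).
  have zb : pochhammer (a - b + 1) m != 0.
    by apply: pochhammer_neq0 => i im; rewrite nzb// (ltn_trans im).
  have zc : pochhammer (a - c + 1) m != 0.
    by apply: pochhammer_neq0 => i im; rewrite nzc// (ltn_trans im).
  have zM : pochhammer (2 * a + M%:R + 1) m != 0.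
    by rewrite gt_eqF// pochhammer_gt0// addrAC ltr_wpDr.
  have zM' : 2 * a + M%:R + 1 + m%:R != 0.
    by rewrite gt_eqF// ltr_wpDr// addrAC ltr_wpDr.
  have zf : (m`!%:R : R) != 0 by rewrite pnatr_eq0 -lt0n fact_gt0.
  have zb' := nzb _ mM; have zc' := nzc _ mM.
  have y_neq0 : a + m.+1%:R != 0 by rewrite gt_eqF.
  have m_neq0 : m.+1%:R != 0 :> R by rewrite pnatr_eq0.
  move: y_neq0 m_neq0; rewrite -!(natr1 m) => y_neq0 m_neq0.

  field.
  by rewrite zf zM zM' zc zb zb' zc' y_neq0 m_neq0.
rewrite (partial M (leqnn M)) /flux [pochhammer (- M%:R) M.+1]pochhammerS.
by rewrite addNr !(mulr0, mul0r).
Qed.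

(** The position of the lattice point [x] in the process at time [t]; it equals
    [(x + t / 2) ^+ 2 - t ^+ 2 / 4], so at fixed [t] it is an even function of
    the node [x + t / 2] of the weights. *)
Definition position t x := (x + t) * x.

Section kernel_moments.
Variables (x s t u : R) (M : nat).
Let v := x + M%:R.
Let C := u + v.
Hypothesis start : 0 < 2 * x + t + 1.
Hypothesis nz_start : forall i, (i < M)%N -> 2 * x + s + 1 + i%:R != 0.
Hypothesis nz_end : forall i, (i < M)%N -> x - C + t + 1 + i%:R != 0.
Hypothesis total : \sum_(j < M.+1) kernel C x s t j M = 1.
Hypothesis su : u - s != 0.

Let start' : 0 < 2 * (x + t / 2) + 1.
Proof. by rewrite mulrDr mulrCA divff// mulr1. Qed.

Let nz_start' i : (i < M)%N ->
  x + t / 2 - (- x - s + t / 2) + 1 + i%:R != 0.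
Proof.
by move=> /nz_start; congr (_ != 0); field.
Qed.

Let nz_end' i : (i < M)%N -> x + t / 2 - (C - t / 2) + 1 + i%:R != 0.
Proof. by move=> /nz_end; congr (_ != 0); field. Qed.

(** With the factor [1] in the summation by parts, the right-hand side is a
    multiple of [y] times an affine function of [y ^+ 2], hence of the
    position. *)
Lemma kernel_mean :
  \sum_(j < M.+1) kernel C x s t j M * position t (x + j%:R)
  = ((u - t) * position s x + (t - s) * position u v) / (u - s).
Proof.
pose a := x + t / 2; pose b := - x - s + t / 2; pose c := C - t / 2.
pose f j := 2 * ((b + c - M%:R) * (a + j%:R) ^+ 2
  + (a * b * c - (a * b + b * c + c * a) * (a + M%:R))).
have zero : \sum_(j < M.+1) kernel C x s t j M * f j = 0.
  apply: (@weight_abel_sum a b c M f (fun=> 1)) => // [j|]; rewrite /f; ring.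
pose mean := ((u - t) * position s x + (t - s) * position u v) / (u - s).
have posE j : position t (x + j%:R) = (2 * (u - s))^-1 * f j + mean.
  by rewrite /mean /f /position /a /b /c /C /v; field.
under eq_bigr => j _ do rewrite posE mulrDr mulrCA.
by rewrite big_split /= -mulr_sumr zero mulr0 add0r -mulr_suml total mul1r.
Qed.

(** The fourth moment of the node comes from a second summation by parts, and
    the variance of [position] is the difference between it and the square of
    the second moment. *)
Lemma kernel_variance : u - s + 1 != 0 ->
  \sum_(j < M.+1) kernel C x s t j M * (position t (x + j%:R)
     - ((u - t) * position s x + (t - s) * position u v) / (u - s)) ^+ 2
  = (t - s) * (u - t) / (u - s + 1)
    * (((position u v - position s x) / (u - s)) ^+ 2
       + (s * position u v - u * position s x) / (u - s)).
Proof.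
move=> su1.
pose a := x + t / 2; pose b := - x - s + t / 2; pose c := C - t / 2.
pose e1 := b + c - M%:R.
pose e2 := a * b + b * c + c * a - (a + b + c) * (a + M%:R).
pose e3 := a * b * c - (a * b + b * c + c * a) * (a + M%:R).
pose e4 := - (a * b * c * (a + M%:R)).
pose f j := 2 * ((e1 + 1) * (a + j%:R) ^+ 4
  + (e2 + e3 + e1 / 4) * (a + j%:R) ^+ 2 + (e4 + e3 / 4)).
have zero : \sum_(j < M.+1) kernel C x s t j M * f j = 0.
  (* The factor [(y - 1 / 2) ^+ 2] becomes [(y + 1 / 2) ^+ 2], its reflection,
     at the next node, so that the right-hand side below is an odd polynomial
     in [y]. *)
  apply: (@weight_abel_sum a b c M f (fun j => (a + j%:R - 2^-1) ^+ 2)) => //.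
    by move=> j; rewrite -(natr1 j) /f /e1 /e2 /e3 /e4; field.
  by rewrite /f /e1 /e2 /e3 /e4; field.
pose mean := ((u - t) * position s x + (t - s) * position u v) / (u - s).
have e1E : e1 = u - s by rewrite /e1 /b /c /C /v; field.
have mean_sum : \sum_(j < M.+1) kernel C x s t j M * position t (x + j%:R) = mean.
  exact: kernel_mean.
have sqE j : (position t (x + j%:R) - mean) ^+ 2
    = (2 * (e1 + 1))^-1 * f j
      - ((e2 + e3 + e1 / 4) / (e1 + 1) + t ^+ 2 / 2 + 2 * mean)
        * position t (x + j%:R)
      + (mean ^+ 2 - t ^+ 4 / 16 - ((e2 + e3 + e1 / 4) * (t ^+ 2 / 4)
          + (e4 + e3 / 4)) / (e1 + 1)).
  rewrite /f e1E; move: (mean) (e2) (e3) (e4) => mu f2 f3 f4.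
  by rewrite /position /a; field.
under eq_bigr => j _ do
  rewrite -/mean sqE mulrDr mulrBr mulrCA (mulrCA _ _ (position _ _)).
rewrite big_split sumrB /= -!mulr_sumr zero mean_sum mulr0 -mulr_suml total.
rewrite e1E /mean /e2 /e3 /e4 /e1 /position /a /b /c /C /v.
field.
by rewrite su1 su.
Qed.

End kernel_moments.
End moments.

(** * Finite-valued random variables and Dynkin's argument *)

Section finite_valued.
Context {R : realType} {d : measure_display} {T : measurableType d}.
Variable P : probability T R.
Implicit Types (E H : set T) (G : set (set T)).

Definition pr E : R := fine (P E).

Lemma EFin_pr E : measurable E -> (pr E)%:E = P E.
Proof. by move=> mE; rewrite /pr fineK// fin_num_measure. Qed.

Lemma pr_eq0 E : P E = 0%E -> pr E = 0.
Proof. by rewrite /pr => ->. Qed.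

Lemma pr_subset E H : measurable E -> measurable H -> E `<=` H ->
  pr H = 0 -> pr E = 0.
Proof.
move=> mE mH EH pH; have PH : P H = 0%E by rewrite -EFin_pr// pH.
suff -> : pr E = fine 0%E by [].
by congr fine; apply/eqP; rewrite -measure_le0 -PH le_measure// inE.
Qed.

Context {F : finType} (phi : T -> F).
Hypothesis mphi : forall c, measurable (phi @^-1` [set c]).

Lemma indic_expansion (h : F -> R) : EFin \o (h \o phi)
  = (fun w => \sum_(c : F) (h c)%:E * (\1_(phi @^-1` [set c]) w)%:E)%E.
Proof.
apply/funext => w /=; rewrite (bigD1 (phi w)) //= indicE mem_set// mule1.
by rewrite big1 ?adde0// => c cw; rewrite indicE memNset ?mule0// => /= wc;
  rewrite wc eqxx in cw.
Qed.

Lemma integrable_finite_valued (h : F -> R) :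
  P.-integrable setT (EFin \o (h \o phi)).
Proof.
rewrite indic_expansion; apply: integrable_sum => // c _.
by apply: integrableZl => //; exact: integrable_indic.
Qed.

Lemma integral_finite_valued (h : F -> R) H : measurable H ->
  (\int[P]_(w in H) (h (phi w))%:E
   = (\sum_(c : F) h c * pr (H `&` phi @^-1` [set c])%classic)%:E)%E.
Proof.
move=> mH; have /= := indic_expansion h.
rewrite /comp => ->.
rewrite integral_sum//; last first.
  move=> c; apply: integrableZl => //.
  by apply: (@integrableS _ _ _ _ setT) => //; exact: integrable_indic.
rewrite -sumEFin; apply: eq_bigr => c _.
rewrite integralZl//; last first.
  by apply: (@integrableS _ _ _ _ setT) => //; exact: integrable_indic.
rewrite integral_indic// EFinM EFin_pr 1?setIC//.
by apply: measurableI.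
Qed.

Lemma measurable_finite_valued (h : F -> R) : measurable_fun setT (h \o phi).
Proof.
by have /integrableP[mh _] := integrable_finite_valued h; apply/measurable_EFinP.
Qed.

Lemma Lfun2_finite_valued (h : F -> R) : (h \o phi) \in Lfun P 2%:E.
Proof.
rewrite inE; apply/andP; split; rewrite inE/=.
  exact: measurable_finite_valued.
rewrite /finite_norm unlock poweR_lty//.
under eq_integral => w _ do
  rewrite (_ : (`|(EFin \o (h \o phi)) w| `^ 2 = (`|h (phi w)| `^ 2)%:E)%E)//.
by rewrite (integral_finite_valued (fun c => `|h c| `^ 2)) ?ltry.
Qed.

End finite_valued.

Section dynkin.
Context {R : realType} {d : measure_display} {T : measurableType d}.
Variable P : probability T R.
Implicit Types (A B E H : set T) (G : set (set T)).

Local Notation pr := (pr P).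

Lemma pr_setD A E H : measurable A -> measurable E -> measurable H ->
  H `<=` E -> pr (A `&` (E `\` H)) = pr (A `&` E) - pr (A `&` H).
Proof.
move=> mA mE mH HE; rewrite /pr.
have -> : A `&` (E `\` H) = (A `&` E) `\` (A `&` H).
  apply/seteqP; split=> w /=; first by case=> ? [? ?]; split => // -[].
  by case=> -[? ?] nAH; split => //; split => // ?; apply: nAH.
rewrite measureD; [|exact: measurableI|exact: measurableI|]; last first.
  by rewrite ltey_eq fin_num_measure//; exact: measurableI.
rewrite (_ : A `&` E `&` (A `&` H) = A `&` H); last first.
  by rewrite setIACA setIid (setIidr HE).
by rewrite fineB// fin_num_measure//; exact: measurableI.
Qed.

Lemma pr_bigcup_cvg A (F : (set T)^nat) : measurable A ->
  (forall n, measurable (F n)) -> {homo F : n m / (n <= m)%N >-> (n <= m)%O} ->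
  pr (A `&` F n) @[n --> \oo] --> pr (A `&` \bigcup_n F n).
Proof.
move=> mA mF ndF; rewrite setI_bigcupr; apply: fine_cvg.
rewrite -/(pr _) EFin_pr; last first.
  by apply: bigcup_measurable => n _; exact: measurableI.
apply: nondecreasing_cvg_mu => [n||n m nm]; first exact: measurableI.
  by apply: bigcup_measurable => n _; exact: measurableI.
by rewrite subsetEset; apply: setIS; rewrite -subsetEset; exact: ndF.
Qed.

(** Dynkin's argument.  The coefficients are arbitrary reals, since transition
    weights given by a formula carry no sign information; so the lambda-system
    is built from the equation itself rather than from the uniqueness of
    measures. *)
Lemma pr_eq_g_sigma_algebra G A B (a b : R) :
  setI_closed G -> G `<=` measurable -> G setT -> measurable A -> measurable B ->
  (forall H, G H -> a * pr (A `&` H) = b * pr (B `&` H)) ->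
  forall H, <<s G >> H -> a * pr (A `&` H) = b * pr (B `&` H).
Proof.
move=> GI Gm GT mA mB GE.
pose L := [set H | measurable H /\ a * pr (A `&` H) = b * pr (B `&` H)].
suff GL : <<s G >> `<=` L by move=> H /GL[].
apply: lambda_system_subset => //; last by move=> H GH; split; [exact: Gm|exact: GE].
split => //; first by split => //; exact: GE.
- move=> E H HE [mE EE] [mH EH]; split; first exact: measurableD.
  by rewrite !pr_setD// !mulrBr EE EH.
- move=> F ndF LF; have mF n : measurable (F n) by case: (LF n).
  split; first exact: bigcup_measurable.
  have lim D c : measurable D ->
      c * pr (D `&` F n) @[n --> \oo] --> c * pr (D `&` \bigcup_n F n).
    by move=> mD; apply: cvgM; [exact: cvg_cst|exact: pr_bigcup_cvg].
  have limA := lim A a mA; have := lim B b mB.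
  under eq_fun => n do rewrite -(LF n).2.
  by move=> limB; exact: (cvg_unique _ limA limB).
Qed.

End dynkin.

(** * Conditional expectations as finite sums *)

Section finite_conditioning.
Context {R : realType} {d : measure_display} {T : measurableType d}.
Variable P : probability T R.
Implicit Types (E H : set T) (G : set (set T)).

Local Notation pr := (pr P).

Lemma pr_sum_fibers (F : finType) (phi : T -> F) H :
  (forall c, measurable (phi @^-1` [set c])) -> measurable H ->
  \sum_(c : F) pr (H `&` phi @^-1` [set c]) = pr H.
Proof.
move=> mphi mH; have := integral_finite_valued P mphi (fun=> 1) mH.
rewrite integral_cst// mul1e => PH; rewrite -[RHS]/(fine (P H)) PH /=.
by apply: eq_bigr => c _; rewrite mul1r.
Qed.

Context {F1 F2 : finType} (kappa : T -> F1) (nu : T -> F2).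
Hypothesis mkappa : forall c, measurable (kappa @^-1` [set c]).
Hypothesis mnu : forall n, measurable (nu @^-1` [set n]).
Variables (q f : F1 -> F2 -> R) (g : F1 -> R).
(* The total mass of [q c] is one as soon as [c] is visited with positive
   probability, so the mean over [q c] is asked for in that case alone. *)
Hypothesis q_mean :
  forall c, \sum_n q c n = 1 -> \sum_n q c n * f c n = g c.

Let pair_fiber c n :
  (fun w => (kappa w, nu w)) @^-1` [set (c, n)]
  = kappa @^-1` [set c] `&` nu @^-1` [set n].
Proof. by apply/seteqP; split=> w /= => [[]|[-> ->]]. Qed.

Let mpair c : measurable ((fun w => (kappa w, nu w)) @^-1` [set c]).
Proof. by case: c => c n; rewrite pair_fiber; exact: measurableI. Qed.

(** When [q c] is the conditional law of [nu] given [kappa = c] on [H], the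
    integral over [H] is computed fibre by fibre of [kappa]. *)
Lemma integral_kernel H : measurable H ->
  (forall c n, pr (H `&` kappa @^-1` [set c] `&` nu @^-1` [set n])
     = pr (H `&` kappa @^-1` [set c]) * q c n) ->
  (\int[P]_(w in H) (g (kappa w))%:E
   = \int[P]_(w in H) (f (kappa w) (nu w))%:E)%E.
Proof.
move=> mH qE; rewrite (integral_finite_valued _ mkappa)//.
rewrite (integral_finite_valued _ mpair (fun c => f c.1 c.2))//.
congr EFin; pose term c n := f c n *
  pr (H `&` (fun w => (kappa w, nu w)) @^-1` [set (c, n)]).
rewrite [RHS](eq_bigr (fun p => term p.1 p.2)); last by case.
rewrite -(pair_bigA _ term) {}/term /=.
apply: eq_bigr => c _.
under eq_bigr => n _ do rewrite pair_fiber setIA qE mulrCA.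
rewrite -mulr_sumr [LHS]mulrC.
have [->|prc] := eqVneq (pr (H `&` kappa @^-1` [set c])) 0; first by rewrite !mul0r.
congr (_ * _); rewrite -q_mean; first by apply: eq_bigr => n _; rewrite mulrC.
apply: (mulfI prc); rewrite mulr1 mulr_sumr.
under eq_bigr => n _ do rewrite -qE.
by rewrite pr_sum_fibers//; exact: measurableI.
Qed.

(** The sigma-algebra [G] may be coarser than the one generated by [kappa]: only
    [Y] has to be measurable for it.  This matters because the observed process
    need not determine the state of the chain. *)
Lemma is_cond_exp_kernel G (X Y : T -> R) : G `<=` measurable ->
  (forall w, X w = f (kappa w) (nu w)) -> (forall w, Y w = g (kappa w)) ->
  (forall H, G H -> forall c n,
     pr (H `&` kappa @^-1` [set c] `&` nu @^-1` [set n])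
     = pr (H `&` kappa @^-1` [set c]) * q c n) ->
  g_sigma_algebra_preimage Y `<=` G -> is_cond_exp P G X Y.
Proof.
move=> Gm /funext -> /funext -> qE gG; split => //.
  exact: integrable_finite_valued.
by move=> E GE; apply: integral_kernel; [exact: Gm|exact: qE].
Qed.

End finite_conditioning.

(** * Past, future and bridges of a Markov chain *)

Section markov_chain.
Context {R : realType} {d : measure_display} {T : measurableType d}.
Variables (P : probability T R) (D : set R) (xi : R -> T -> nat).
Hypothesis mxi : forall t, D t -> measurable_fun setT (xi t).
Hypothesis markov : forall s t, D s -> D t -> s < t -> forall n : nat,
  is_cond_exp P (process_sigma xi [set r | D r /\ r <= s])
    (\1_[set w | xi t w = n])
    (fun w => cond_prob P [set v | xi t v = n] [set v | xi s v = xi s w]).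
Implicit Types (s t u r : R) (k m n : nat) (H E : set T) (I J : set R).

Local Notation pr := (pr P).
Local Notation sigma := (process_sigma xi).
Local Notation at_ t n := [set w | xi t w = n].
Let past s := [set r | D r /\ r <= s].
Let future u := [set r | D r /\ u <= r].
Let outside s u := [set r | D r /\ (r <= s \/ u <= r)].

Lemma process_sigma_sub I J : I `<=` J -> sigma I `<=` sigma J.
Proof. by move=> IJ; apply: sub_sigma_algebra2; exact: bigcup_subset. Qed.

Lemma process_sigmaT I : sigma I setT.
Proof. exact: (@measurableT _ (g_sigma_algebraType _)). Qed.

Lemma process_sigmaI I H E : sigma I H -> sigma I E -> sigma I (H `&` E).
Proof. exact: (@measurableI _ (g_sigma_algebraType _)). Qed.

Lemma process_sigma_state I t n : I t -> sigma I (at_ t n).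
Proof.
move=> It; apply: sub_sigma_algebra; exists t => //.
by exists [set n] => //; rewrite setTI.
Qed.

Lemma process_sigma_measurable I : I `<=` D -> sigma I `<=` measurable.
Proof.
move=> ID; apply: smallest_sub; first exact: sigma_algebra_measurable.
by move=> _ [t /ID Dt [B mB <-]]; exact: mxi.
Qed.

Lemma measurable_state t n : D t -> measurable (at_ t n).
Proof.
move=> Dt; apply: (@process_sigma_measurable D) => //.
exact: process_sigma_state.
Qed.

Lemma markov_step s t k n H : D s -> D t -> s < t -> sigma (past s) H ->
  pr (H `&` at_ s k `&` at_ t n)
  = pr (H `&` at_ s k) * cond_prob P (at_ t n) (at_ s k).
Proof.
move=> Ds Dt st sH; have [_ _ cexp] := markov Ds Dt st n.
have sHk : sigma (past s) (H `&` at_ s k).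
  by apply: process_sigmaI => //; apply: process_sigma_state; split.
have mHk : measurable (H `&` at_ s k).
  by apply: process_sigma_measurable sHk => r [].
have /(congr1 fine) := cexp _ sHk.
rewrite integral_indic//; last exact: measurable_state.
rewrite (eq_integral (cst (cond_prob P (at_ t n) (at_ s k))%:E)); last first.
  by move=> w; rewrite inE => -[_ /= ->].
rewrite integral_cst// fineM ?fin_num_measure//= => prE.
by rewrite setIC [RHS]mulrC; exact: esym prE.
Qed.

(** A list of prescriptions may be unsorted and may mention a time twice, so
    that intersecting two cylinders is concatenating their lists. *)
Definition cylinder (L : seq (R * nat)) : set T :=
  [set w | all (fun p => xi p.1 w == p.2) L].

Definition cylinders I : set (set T) :=
  [set H | exists2 L, (forall p, p \in L -> I p.1) & H = cylinder L].

Lemma cylinder_cons t n L : cylinder ((t, n) :: L) = at_ t n `&` cylinder L.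
Proof.
apply/seteqP; split=> w; rewrite /cylinder /=; first by case/andP=> /eqP.
by case=> -> ->; rewrite eqxx.
Qed.

Lemma cylinders_setI I : setI_closed (cylinders I).
Proof.
move=> _ _ [L1 IL1 ->] [L2 IL2 ->]; exists (L1 ++ L2).
  by move=> p; rewrite mem_cat => /orP[/IL1|/IL2].
by apply/seteqP; split=> w; rewrite /cylinder /= all_cat => /andP.
Qed.

Lemma cylindersT I : cylinders I setT.
Proof. by exists [::] => //; apply/seteqP; split. Qed.

Lemma process_sigma_cylinder I L : (forall p, p \in L -> I p.1) ->
  sigma I (cylinder L).
Proof.
elim: L => [_|[t n] L IH IL].
  by rewrite (_ : cylinder [::] = setT); [exact: process_sigmaT|apply/seteqP].
rewrite cylinder_cons; apply: process_sigmaI.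
  by apply: process_sigma_state; apply: (IL (t, n)); rewrite mem_head.
by apply: IH => p pL; apply: IL; rewrite in_cons pL orbT.
Qed.

Lemma process_sigma_cylinders I : sigma I `<=` <<s cylinders I >>.
Proof.
apply: smallest_sub; first exact: smallest_sigma_algebra.
move=> _ [t It [B mB <-]]; rewrite setTI.
rewrite (_ : xi t @^-1` B = \bigcup_(n in B) at_ t n); last first.
  by apply/seteqP; split=> w /= => [Bw|[n Bn ->]//]; exists (xi t w).
apply: (@bigcup_measurable _ (g_sigma_algebraType (cylinders I))) => n _.
apply: sub_sigma_algebra; exists [:: (t, n)].
  by move=> p; rewrite inE => /eqP ->.
by rewrite cylinder_cons; apply/seteqP; split=> w //= -[].
Qed.

Lemma cylinder_sort L : cylinder L = cylinder (sort (relpre fst <=%R) L).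
Proof. by rewrite /cylinder; under [RHS]eq_set => w do rewrite all_sort. Qed.

(** Iterating [markov_step] along the cylinder, in increasing order of time,
    produces a product of transition probabilities; all that is retained of it
    is that it does not depend on the past event. *)
Lemma markov_cylinder L u m : D u -> (forall p, p \in L -> D p.1) ->
  path (relpre fst <=%R) (u, m) L ->
  exists c, forall H, sigma (past u) H ->
    pr (H `&` at_ u m `&` cylinder L) = pr (H `&` at_ u m) * c.
Proof.
elim: L u m => [|[r n] L IH] u m Du DL.
  move=> _; exists 1 => H sH; rewrite mulr1; congr pr.
  by apply/seteqP; split=> w //= -[].
move=> /= /andP[ur pL].
have Dr : D r by apply: (DL (r, n)); rewrite mem_head.
have [|c cE] := IH r n Dr _ pL.
  by move=> p pL'; apply: DL; rewrite in_cons pL' orbT.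
have [ur' {ur}|ru] := ltP u r.
  exists (cond_prob P (at_ r n) (at_ u m) * c) => H sH.
  rewrite cylinder_cons setIA cE; first by rewrite markov_step// mulrA.
  apply: process_sigmaI.
    by apply: process_sigma_sub sH => x [Dx xu]; split => //; rewrite (le_trans xu)// ltW.
  by apply: process_sigma_state; split => //; exact: ltW.
have {ur ru} ru : r = u by apply/eqP; rewrite eq_le ru.
subst r; have [nm|nm] := eqVneq m n; first rewrite {m}nm.
  exists c => H sH; rewrite cylinder_cons -cE//; congr pr.
  by rewrite setIA -(setIA H) setIid.
exists 0 => H sH; rewrite mulr0 cylinder_cons.
rewrite (_ : _ `&` _ = set0) ?/pr ?measure0//.
by apply/seteqP; split=> w //= -[[_ um] [un _]]; rewrite -um -un eqxx in nm.
Qed.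

(** The symmetric form of the Markov property.  It is multiplied out by the
    probability of the present state, so that it also holds when that
    probability is zero. *)
Lemma past_future_independent u m H E : D u ->
  sigma (past u) H -> sigma (future u) E ->
  pr (at_ u m) * pr (H `&` at_ u m `&` E)
  = pr (H `&` at_ u m) * pr (at_ u m `&` E).
Proof.
move=> Du sH /process_sigma_cylinders; move: E.
have mH : measurable H by apply: process_sigma_measurable sH => r [].
apply: pr_eq_g_sigma_algebra => //.
- exact: cylinders_setI.
- move=> _ [L fL ->]; apply: (@process_sigma_measurable (future u)) => [r []//|].
  exact: process_sigma_cylinder.
- exact: cylindersT.
- by apply: measurableI => //; exact: measurable_state.
- exact: measurable_state.
move=> _ [L fL ->]; rewrite cylinder_sort.
have [||c cE] := @markov_cylinder (sort (relpre fst <=%R) L) u m Du.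
- by move=> p; rewrite mem_sort => /fL[].
- rewrite path_sortedE; last by move=> x y z; exact: le_trans.
  apply/andP; split; last by apply: sort_sorted => x y; exact: le_total.
  by apply/allP => p; rewrite mem_sort => /fL[].
- have := cE setT (@process_sigmaT (past u)); rewrite !setTI => ->.
  by rewrite cE// mulrCA.
Qed.

Variables (N : nat) (p : R -> R -> nat -> nat -> R).
Hypothesis transition : forall s t, D s -> D t -> s < t ->
  forall k n, (k <= N)%N -> (n <= N)%N -> P (at_ s k) != 0%E ->
  cond_prob P (at_ t n) (at_ s k) = p s t k n.

Lemma past_law s t k n H : D s -> D t -> s < t -> (k <= N)%N -> (n <= N)%N ->
  sigma (past s) H ->
  pr (H `&` at_ s k `&` at_ t n) = pr (H `&` at_ s k) * p s t k n.
Proof.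
move=> Ds Dt st kN nN sH; rewrite markov_step//.
have [P0|/transition->//] := eqVneq (P (at_ s k)) 0%E.
rewrite (_ : pr (H `&` at_ s k) = 0) ?mul0r//.
have mH : measurable H by apply: process_sigma_measurable sH => r [].
have ms := measurable_state k Ds.
apply: (pr_subset _ ms (@subIsetr _ _ _)); first exact: measurableI.
exact: pr_eq0.
Qed.

(** The chain run backwards: by [past_future_independent] the elementary
    conditional probability given the present state alone is enough. *)
Lemma future_law t u n m q H : D t -> D u -> t < u -> sigma (future u) H ->
  pr (at_ t n `&` at_ u m) = pr (at_ u m) * q ->
  pr (H `&` at_ u m `&` at_ t n) = pr (H `&` at_ u m) * q.
Proof.
move=> Dt Du tu sH tuq.
have mH : measurable H by apply: process_sigma_measurable sH => r [].
have mt := measurable_state n Dt; have mu := measurable_state m Du.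
have [u0|u0] := eqVneq (pr (at_ u m)) 0.
  have Hu0 : pr (H `&` at_ u m) = 0.
    by apply: (pr_subset _ mu (@subIsetr _ _ _)) => //; exact: measurableI.
  rewrite Hu0 mul0r; apply: (pr_subset _ _ (@subIsetl _ _ _) Hu0).
    by apply: measurableI => //; exact: measurableI.
  exact: measurableI.
have st : sigma (past u) (at_ t n).
  by apply: process_sigma_state; split => //; exact: ltW.
apply: (mulfI u0); rewrite [RHS]mulrCA -tuq.
rewrite [H `&` at_ u m `&` at_ t n]setIC (setIC H) setIA.
by rewrite past_future_independent// mulrC.
Qed.

(** On the intersection of a past and a future event, [past_future_independent]
    at time [u] splits off the future event and [past_law] splits off the past
    one; these intersections form a pi-system generating the sigma-algebra of
    the outside. *)
Lemma bridge_law s t u k n m q H : D s -> D t -> D u -> s < t -> t < u ->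
  (k <= N)%N -> (n <= N)%N -> (m <= N)%N ->
  p s t k n * p t u n m = p s u k m * q ->
  sigma (outside s u) H ->
  pr (H `&` (at_ s k `&` at_ u m) `&` at_ t n)
  = pr (H `&` (at_ s k `&` at_ u m)) * q.
Proof.
move=> Ds Dt Du st tu kN nN mN pq.
have su := lt_trans st tu.
have ms := measurable_state k Ds; have mt := measurable_state n Dt.
have mu := measurable_state m Du.
have past_meas r E : sigma (past r) E -> measurable E.
  by apply: process_sigma_measurable => ? [].
have future_meas r E : sigma (future r) E -> measurable E.
  by apply: process_sigma_measurable => ? [].
pose G := [set E `&` F | E in sigma (past s) & F in sigma (future u)].
have GI : setI_closed G.
  move=> _ _ [E1 sE1 [F1 sF1 <-]] [E2 sE2 [F2 sF2 <-]].
  exists (E1 `&` E2); first exact: process_sigmaI.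
  by exists (F1 `&` F2); [exact: process_sigmaI|rewrite setIACA].
have GT : G setT.
  exists setT; first exact: process_sigmaT.
  by exists setT; [exact: process_sigmaT|rewrite setTI].
have sG : sigma (outside s u) `<=` <<s G >>.
  apply: smallest_sub; first exact: smallest_sigma_algebra.
  move=> E [r [Dr rsu] rE]; apply: sub_sigma_algebra.
  case: rsu => rsu.
    exists E; last by exists setT; [exact: process_sigmaT|rewrite setIT].
    by apply: sub_sigma_algebra; exists r.
  exists setT; first exact: process_sigmaT.
  by exists E; [apply: sub_sigma_algebra; exists r|rewrite setTI].
suff GE : forall H, G H ->
    1 * pr (at_ s k `&` at_ u m `&` at_ t n `&` H)
    = q * pr (at_ s k `&` at_ u m `&` H).
  move=> /sG sH; rewrite (setIC H) setIAC [RHS]mulrC -[LHS]mul1r.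
  apply: pr_eq_g_sigma_algebra sH => //; last 2 first.
  - by apply: measurableI => //; exact: measurableI.
  - exact: measurableI.
  move=> _ [E /past_meas mE [F /future_meas mF <-]]; exact: measurableI.
move=> _ [E sE [F sF <-]]; rewrite mul1r.
have mE := past_meas _ _ sE; have mF := future_meas _ _ sF.
have sEu I : [set r | D r /\ r <= s] `<=` I -> I s -> sigma I (E `&` at_ s k).
  move=> sI Is; apply: process_sigmaI; last exact: process_sigma_state.
  exact: process_sigma_sub sE.
have sEt : sigma (past t) (E `&` at_ s k).
  by apply: sEu => [r [Dr rs]|]; split => //; [rewrite (le_trans rs)// ltW|exact: ltW].
have sE' : sigma (past u) (E `&` at_ s k).
  by apply: sEu => [r [Dr rs]|]; split => //; [rewrite (le_trans rs)// ltW|exact: ltW].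
have sEn : sigma (past u) (E `&` at_ s k `&` at_ t n).
  apply: process_sigmaI => //; apply: process_sigma_state; split => //.
  exact: ltW.
have -> : at_ s k `&` at_ u m `&` at_ t n `&` (E `&` F)
    = E `&` at_ s k `&` at_ t n `&` at_ u m `&` F.
  by apply/seteqP; split=> w /=; tauto.
have -> : at_ s k `&` at_ u m `&` (E `&` F) = E `&` at_ s k `&` at_ u m `&` F.
  by apply/seteqP; split=> w /=; tauto.
have [u0|u0] := eqVneq (pr (at_ u m)) 0.
  have null A : measurable A -> A `<=` at_ u m -> pr A = 0.
    by move=> mA Au; exact: (pr_subset mA mu Au).
  rewrite !null ?mulr0// => [|w [[]]//||w [[]]//].
    by do ?[apply: measurableI => //].
  by do ?[apply: measurableI => //].
apply: (mulfI u0); rewrite mulrCA.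
rewrite (past_future_independent m Du sEn sF).
rewrite (past_future_independent m Du sE' sF).
rewrite (past_law Dt Du tu nN mN sEt) (past_law Ds Dt st kN nN sE).
rewrite (past_law Ds Du su kN mN sE) -[_ * p s t k n * _]mulrA pq.
by ring.
Qed.

End markov_chain.

(** * The change of time and the parameters *)

Section time_change.
Variable R : realType.
Variables A B C Nr eps rho : R.

Let s0 := - (A + B).
Let t1 := C - A - Nr.
Let E := B + C - Nr.
Let scale := eps * (E + 1) / rho.
Let y0 := - (A * B).
Let y1 := (A + Nr) * C.

(** The Moebius map sending [0] to the birth time [s0 = - (A + B)] of the chain
    and [eps] times infinity to its absorption time [t1 = C - A - N]. *)
Definition mobius_num (tau : R) := scale * (s0 + eps * t1 * tau).
Definition mobius_den (tau : R) := scale * (1 + eps * tau).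
Definition mobius (tau : R) := mobius_num tau / mobius_den tau.

(** The mean of the process, affine in the original time: it interpolates
    between the deterministic values [y0] at time [s0] and [y1] at [t1]. *)
Definition mean_position (tau : R) :=
  (y0 + eps * y1 * tau) / (1 + eps * tau).

Definition eta_ :=
  - ((A * (B + C + Nr) + C * (B + C) + Nr * (Nr - B)) / rho).
Definition theta_ :=
  eps * ((A * (B + C + Nr) - B * (B + C - Nr) + 2 * C * Nr) / rho).
Definition sigma_ := eps / (E + 1).
Definition gamma_ := 1 - 2 / (E + 1).

Hypothesis eps1 : eps ^+ 2 = 1.
Hypothesis rho2 : rho ^+ 2 =
  eps * (E + 1) * (Nr * (A + C) * (B + C) * (A - B + Nr)).
Hypothesis rho_neq0 : rho != 0.
Hypothesis E_neq0 : E != 0.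
Hypothesis E1_neq0 : E + 1 != 0.

Let eps_cases : eps = 1 \/ eps = -1.
Proof.
by have /eqP := eps1; rewrite sqrf_eq1 => /orP[] /eqP; [left|right].
Qed.

Let eps_neq0 : eps != 0.
Proof. by case: eps_cases => ->; rewrite ?oppr_eq0 oner_eq0. Qed.

Let scale_neq0 : scale != 0.
Proof. by rewrite !mulf_neq0 ?invr_neq0. Qed.

Let scale2 : scale ^+ 2 * (Nr * (A + C) * (B + C) * (A - B + Nr)) = eps * (E + 1).
Proof.
have -> : scale ^+ 2 * (Nr * (A + C) * (B + C) * (A - B + Nr))
    = eps * (E + 1) * rho ^+ 2 / rho ^+ 2.
  by rewrite rho2 /scale exprMn exprMn exprVn rho2; ring.
by rewrite mulfK// expf_neq0.
Qed.

Lemma mobiusE tau : 1 + eps * tau != 0 ->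
  mobius tau = s0 + E * (eps * tau / (1 + eps * tau)).
Proof.
move=> tau_neq0; rewrite /mobius /mobius_num /mobius_den /E /s0 /t1.
by field; rewrite scale_neq0 tau_neq0.
Qed.

Lemma mobius_inv r : t1 - r != 0 -> mobius (eps * (r - s0) / (t1 - r)) = r.
Proof.
move=> t1r.
have sE : eps * (eps * (r - s0) / (t1 - r)) = (r - s0) / (t1 - r).
  by rewrite !mulrA -expr2 eps1 mul1r.
have dE : 1 + (r - s0) / (t1 - r) = E / (t1 - r).
  by rewrite -[1](divff t1r) -mulrDl; congr (_ / _); rewrite /E /t1 /s0; ring.
have d_neq0 : E / (t1 - r) != 0 by rewrite mulf_neq0 ?invr_eq0.
by rewrite mobiusE sE dE//; field; rewrite E_neq0 t1r.
Qed.

Lemma mobius_sub s t : 1 + eps * s != 0 -> 1 + eps * t != 0 ->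
  mobius t - mobius s = E * eps * (t - s) / ((1 + eps * s) * (1 + eps * t)).
Proof.
by move=> sn tn; rewrite !mobiusE//; field; rewrite sn tn.
Qed.

(** [p] and [q] are the slope and the intercept of the line through two values
    of the rescaled process before centring, [P] and [Q] the same after
    centring.  Up to a common factor, the left-hand side is the conditional
    variance of the chain and the right-hand side that of the harness; the
    coefficients of [P] and [Q] define
    [theta_] and [eta_], and the constant term is the equation which fixes
    [rho]. *)
Let harness_form (P Q : R) (p := P + scale * (eps * y1))
    (q := Q + scale * y0) :
  (p - eps * q) ^+ 2 + scale * E * (eps * s0 * p - t1 * q)
  = eps * (E + 1) * (1 + eta_ * Q + theta_ * P + sigma_ * Q ^+ 2
      + sigma_ * P ^+ 2 - (1 - gamma_) * (P * Q)).
Proof.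
have K : Nr * (A + C) * (B + C) * (A - B + Nr)
    = (y1 - y0) ^+ 2 + E * (s0 * y1 - t1 * y0).
  by rewrite /y1 /y0 /E /s0 /t1; ring.
rewrite /p /q.
have -> : eps * (E + 1) * (1 + eta_ * Q + theta_ * P + sigma_ * Q ^+ 2
      + sigma_ * P ^+ 2 - (1 - gamma_) * (P * Q))
   = eps * (E + 1) + scale * rho * eta_ * Q + scale * rho * theta_ * P
     + eps * (E + 1) * sigma_ * (Q ^+ 2 + P ^+ 2)
     - eps * (E + 1) * (1 - gamma_) * (P * Q).
  by rewrite /scale divfK//; ring.
have -> : scale * rho * eta_ = scale *
    - (A * (B + C + Nr) + C * (B + C) + Nr * (Nr - B)).
  by rewrite /eta_; field.
have -> : scale * rho * theta_ = scale *
    (eps * (A * (B + C + Nr) - B * (B + C - Nr) + 2 * C * Nr)).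
  by rewrite /theta_; field.
have -> : eps * (E + 1) * sigma_ = eps ^+ 2 by rewrite /sigma_; field.
have -> : eps * (E + 1) * (1 - gamma_) = 2 * eps by rewrite /gamma_; field.
rewrite -scale2 K.
move: scale => c; rewrite /y1 /y0 /E /s0 /t1.
by case: eps_cases => ->; ring.
Qed.

(** Centring and rescaling turn a value [y] of the process at the time
    [mobius tau] into the corresponding value of the harness. *)
Definition rescale (tau y : R) := mobius_den tau * (y - mean_position tau).

(** Linear interpolation is a projective notion: an affine function of the old
    time, multiplied by the denominator of the Moebius map, is an affine function
    of the new time. *)
Lemma rescale_bridge_mean s t u ys yu :
  1 + eps * s != 0 -> 1 + eps * t != 0 -> 1 + eps * u != 0 -> u - s != 0 ->
  rescale t (((mobius u - mobius t) * ys + (mobius t - mobius s) * yu)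
             / (mobius u - mobius s))
  = (u - t) / (u - s) * rescale s ys + (t - s) / (u - s) * rescale u yu.
Proof.
move=> sn tn un us; rewrite !mobius_sub// /rescale /mobius_den /mean_position.
move: (scale) => c; move: (y0) (y1) => z0 z1.
by field; rewrite sn tn un us eps_neq0 E_neq0.
Qed.

Lemma rescale_bridge_variance s t u ys yu
    (zs := rescale s ys) (zu := rescale u yu) :
  1 + eps * s != 0 -> 1 + eps * t != 0 -> 1 + eps * u != 0 -> u - s != 0 ->
  mobius u - mobius s + 1 != 0 ->
  mobius_den t ^+ 2 * ((mobius t - mobius s) * (mobius u - mobius t)
     / (mobius u - mobius s + 1)
     * (((yu - ys) / (mobius u - mobius s)) ^+ 2
        + (mobius s * yu - mobius u * ys) / (mobius u - mobius s)))
  = (u - t) * (t - s) / (u * (1 + sigma_ * s) + sigma_ - gamma_ * s)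
    * (1 + eta_ * ((u * zs - s * zu) / (u - s)) + theta_ * ((zu - zs) / (u - s))
       + sigma_ * ((u * zs - s * zu) ^+ 2 / (u - s) ^+ 2)
       + sigma_ * ((zu - zs) ^+ 2 / (u - s) ^+ 2)
       - (1 - gamma_) * ((zu - zs) * (u * zs - s * zu) / (u - s) ^+ 2)).
Proof.
move=> sn tn un us.
pose den := (1 + eps * s) * (1 + eps * u) + E * eps * (u - s).
have denE : mobius u - mobius s + 1 = den / ((1 + eps * s) * (1 + eps * u)).
  by rewrite mobius_sub// /den; field; rewrite sn un.
rewrite denE mulf_eq0 negb_or => /andP[den_neq0 _].
pose Q := (u * zs - s * zu) / (u - s); pose P := (zu - zs) / (u - s).
have -> : (u * zs - s * zu) ^+ 2 / (u - s) ^+ 2 = Q ^+ 2 by rewrite expr_div_n.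
have -> : (zu - zs) ^+ 2 / (u - s) ^+ 2 = P ^+ 2 by rewrite expr_div_n.
have -> : (zu - zs) * (u * zs - s * zu) / (u - s) ^+ 2 = P * Q.
  by rewrite /P /Q; field.
rewrite -/P -/Q.
have -> : (u - t) * (t - s) / (u * (1 + sigma_ * s) + sigma_ - gamma_ * s)
   = (u - t) * (t - s) / den * (eps * (E + 1)).
  have -> : u * (1 + sigma_ * s) + sigma_ - gamma_ * s = den / (eps * (E + 1)).
    rewrite /sigma_ /gamma_ /den; move: E1_neq0; move: (E) => e e1.
    by case: eps_cases => ->; field.
  by rewrite invf_div; ring.
rewrite -[RHS]mulrA -harness_form.
have PE : P + scale * (eps * y1)
    = scale * (((1 + eps * u) * yu - (1 + eps * s) * ys) / (u - s)).
  rewrite /P /zu /zs /rescale /mobius_den /mean_position.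
  by move: (scale) (y0) (y1) => c z0 z1; field; rewrite sn un us.
have QE : Q + scale * y0
    = scale * ((u * (1 + eps * s) * ys - s * (1 + eps * u) * yu) / (u - s)).
  rewrite /Q /zu /zs /rescale /mobius_den /mean_position.
  by move: (scale) (y0) (y1) => c z0 z1; field; rewrite sn un us.
rewrite PE QE (mobius_sub sn tn) (mobius_sub tn un) (mobius_sub sn un) /mobius_den.
rewrite (mobiusE sn) (mobiusE un).
have -> : t1 = s0 + E by rewrite /t1 /s0 /E; ring.
move: E_neq0 den_neq0; rewrite /den; move: (scale) (E) (s0) => c e b e0.
case: eps_cases => epsE; rewrite epsE ?(mul1r, mulN1r, mulrN1, mulr1, mulNr)
  in sn tn un *; move=> dn.
- by field; rewrite sn tn un us e0 dn.
- by field; rewrite sn tn un us e0 dn.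
Qed.

Lemma mobius_end_sub s : 1 + eps * s != 0 ->
  t1 - mobius s = E / (1 + eps * s).
Proof.
have -> : t1 = s0 + E by rewrite /t1 /s0 /E; ring.
by move=> sn; rewrite mobiusE//; field.
Qed.

(** Conditioning on the past alone is the limiting case in which the later end
    point is the absorption at [t1], where the process takes the value [y1]. *)
Lemma rescale_past_mean s t y : 1 + eps * s != 0 -> 1 + eps * t != 0 ->
  rescale t (((t1 - mobius t) * y + (mobius t - mobius s) * y1)
             / (t1 - mobius s))
  = rescale s y.
Proof.
move=> sn tn; rewrite (mobius_sub sn tn) (mobius_end_sub sn) (mobius_end_sub tn).
rewrite /rescale /mobius_den /mean_position.
move: (scale) (y0) (y1) (E) E_neq0 => c z0 z1 e e0.
by field; rewrite sn tn e0.
Qed.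

Lemma rescale_past_variance s t y (z := rescale s y) :
  1 + eps * s != 0 -> 1 + eps * t != 0 -> t1 - mobius s + 1 != 0 ->
  mobius_den t ^+ 2 * ((mobius t - mobius s) * (t1 - mobius t)
     / (t1 - mobius s + 1)
     * (((y1 - y) / (t1 - mobius s)) ^+ 2
        + (mobius s * y1 - t1 * y) / (t1 - mobius s)))
  = (t - s) / (1 + sigma_ * s) * (sigma_ * z ^+ 2 + eta_ * z + 1).
Proof.
move=> sn tn.
have t1E : t1 = s0 + E by rewrite /t1 /s0 /E; ring.
pose den := E + 1 + eps * s.
have denE : t1 - mobius s + 1 = den / (1 + eps * s).
  by rewrite (mobius_end_sub sn) /den; field.
rewrite denE mulf_eq0 negb_or => /andP[den_neq0 _].
have -> : (t - s) / (1 + sigma_ * s) * (sigma_ * z ^+ 2 + eta_ * z + 1)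
    = eps * (t - s) / den * (eps * (E + 1) * (1 + eta_ * z + theta_ * 0
        + sigma_ * z ^+ 2 + sigma_ * 0 ^+ 2 - (1 - gamma_) * (0 * z))).
  have -> : 1 + sigma_ * s = den / (E + 1).
    by rewrite /sigma_ /den; move: E1_neq0; move: (E) => e e1; field.
  rewrite invf_div mulrCA [eps * (t - s)]mulrC mulrA.
  rewrite [RHS](_ : _ = eps ^+ 2 * ((t - s) * (E + 1) / den
      * (sigma_ * z ^+ 2 + eta_ * z + 1))); last by ring.
  by rewrite eps1; ring.
(* The line through the value [z] at time [s] with slope [0]: its intercept is
   [z], and the slope before centring is that of the mean. *)
rewrite -harness_form add0r.
have -> : z + scale * y0 = scale * ((1 + eps * s) * y - eps * y1 * s).
  rewrite /z /rescale /mobius_den /mean_position.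
  by move: (scale) (y0) (y1) => c z0 z1; field.
rewrite (mobius_sub sn tn) (mobius_end_sub sn) (mobius_end_sub tn).
rewrite t1E (mobiusE sn) /mobius_den.
move: E_neq0 den_neq0; rewrite /den.
move: (scale) (E) (s0) (y1) => c e b z1 e0.
case: eps_cases => epsE; rewrite epsE ?(mul1r, mulN1r, mulrN1, mulr1, mulNr)
  in sn tn *; move=> dn.
- by field; rewrite sn tn e0 dn.
- by field; rewrite sn tn e0 dn.
Qed.

End time_change.

(** * Kernels between the states of the chain *)

Section state_kernel.
Variables (R : realType) (N : nat) (A B C : R).
Implicit Types (s t u : R) (i j k l m n : nat).

Let s0 := - (A + B).

(** The kernel from state [k] to state [n] in the numbering of the chain, with
    absorption in state [m]; it vanishes outside [k <= n <= m], so that sums may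
    run over all the states. *)
Definition state_kernel (C' s t : R) (k m n : nat) : R :=
  if (k <= n <= m)%N then kernel C' (A + k%:R) s t (n - k) (m - k) else 0.

Lemma sum_state_kernel C' s t k m (g : nat -> R) : (k <= m <= N)%N ->
  \sum_(n < N.+1) state_kernel C' s t k m n * g n
  = \sum_(j < (m - k).+1) kernel C' (A + k%:R) s t j (m - k) * g (k + j)%N.
Proof.
move=> /andP[km mN].
rewrite -(big_mkord xpredT (fun n => state_kernel C' s t k m n * g n)).
rewrite (@big_cat_nat _ _ _ k) ?leq0n ?(leq_trans km)//= ?(leq_trans mN)//.
rewrite [X in X + _]big_nat_cond big1 ?add0r; last first.
  by move=> n /andP[/andP[_ nk] _]; rewrite /state_kernel leqNgt nk mul0r.
rewrite (@big_cat_nat _ _ _ m.+1) ?ltnS ?(leq_trans km)//=.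
rewrite [X in _ + X]big_nat_cond [X in _ + X]big1 ?addr0; last first.
  move=> n /andP[/andP[mn _] _].
  by rewrite /state_kernel [(n <= m)%N]leqNgt mn andbF mul0r.
rewrite -{1}[k]add0n big_addn subSn// big_mkord; apply: eq_bigr => j _.
have jm := ltn_ord j; rewrite /state_kernel addnK addnC leq_addr /=.
by rewrite (_ : (k + j <= m)%N = true)//; lia.
Qed.

Hypothesis AB : 0 < A - B + 1.

Lemma start_gt0 s k : s0 <= s -> 0 < 2 * (A + k%:R) + s + 1.
Proof.
by move=> s0s; have := ler0n R k; move: s0s AB; rewrite /s0; lra.
Qed.

Lemma state_kernel_bridge s t u k n m : s0 <= s -> s < t -> t < u ->
  (forall r, r \in [:: s; t; u] -> forall i, (i < N)%N -> A - C + r + 1 + i%:R != 0) ->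
  (m <= N)%N ->
  state_kernel C s t k N n * state_kernel C t u n N m
  = state_kernel C s u k N m * state_kernel (u + (A + m%:R)) s t k m n.
Proof.
move=> s0s st tu reg mN; rewrite /state_kernel mN !andbT.
have [/andP[kn nm]|nknm] := boolP ((k <= n) && (n <= m))%N; last first.
  rewrite mulr0; move: nknm; rewrite negb_and => /orP[] /negbTE ->.
    by rewrite mul0r.
  by rewrite mulr0.
rewrite kn nm (leq_trans kn nm) (leq_trans nm mN) /=.
have regk r : r \in [:: s; t; u] -> forall j, (j < N - k)%N ->
    A + k%:R - C + r + 1 + j%:R != 0.
  move=> rs j jN; have -> : A + k%:R - C + r + 1 + j%:R = A - C + r + 1 + (k + j)%:R.
    by rewrite natrD; ring.
  by apply: reg => //; rewrite -ltn_subRL.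
have eN : (N - k = (n - k) + ((m - n) + (N - m)))%N by lia.
have eNn : (N - n = (m - n) + (N - m))%N by lia.
have em : (m - k = (n - k) + (m - n))%N by lia.
have eA : A + n%:R = A + k%:R + (n - k)%:R :> R by rewrite natrB//; ring.
have eC : u + (A + m%:R) = A + k%:R + u + ((n - k) + (m - n))%:R :> R.
  by rewrite -em natrB ?(leq_trans kn)//; ring.
rewrite eA eC em eNn eN; apply: kernel_bridge => //; rewrite -?eN.
- exact: start_gt0.
- by apply: regk; rewrite mem_head.
- by apply: regk; rewrite !inE eqxx orbT.
- by apply: regk; rewrite !inE eqxx !orbT.
Qed.

Section moments.
Variables (C' s t u : R) (k m : nat).
Hypothesis C'E : C' = u + (A + m%:R).
Hypotheses (s0s : s0 <= s) (s0t : s0 <= t) (us : u - s != 0) (mN : (m <= N)%N).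
Hypothesis absorb : forall i, (i < m - k)%N ->
  A + k%:R - C' + t + 1 + i%:R != 0.
Hypothesis total : \sum_(n < N.+1) state_kernel C' s t k m n = 1.

Let km : (k <= m)%N.
Proof.
rewrite leqNgt; apply/negP => mk; move: total; rewrite big1 => [/esym/eqP|n _].
  by rewrite oner_eq0.
rewrite /state_kernel.
by case: ifP => // /andP[kn nm]; have := leq_ltn_trans (leq_trans kn nm) mk; rewrite ltnn.
Qed.

Let end_point : A + k%:R + (m - k)%:R = A + m%:R :> R.
Proof. by rewrite natrB//; ring. Qed.

Let kernel_total :
  \sum_(j < (m - k).+1) kernel (u + (A + k%:R + (m - k)%:R)) (A + k%:R) s t j (m - k)
  = 1.
Proof.
have kmN : (k <= m <= N)%N by rewrite km.
rewrite end_point -C'E -[RHS]total.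
have := sum_state_kernel C' s t (fun=> 1) kmN.
by under eq_bigr do rewrite mulr1; under [RHS]eq_bigr do rewrite mulr1.
Qed.

Let start i : (i < m - k)%N -> 2 * (A + k%:R) + s + 1 + i%:R != 0.
Proof. by move=> _; rewrite gt_eqF// ltr_wpDr// start_gt0. Qed.

Lemma state_kernel_mean :
  \sum_(n < N.+1) state_kernel C' s t k m n * position t (A + n%:R)
  = ((u - t) * position s (A + k%:R) + (t - s) * position u (A + m%:R)) / (u - s).
Proof.
rewrite (@sum_state_kernel _ _ _ _ _ (fun n => position t (A + n%:R))) ?km//.
rewrite -end_point -kernel_mean//; last first.
- by rewrite end_point -C'E.
- exact: start_gt0.
by rewrite end_point -C'E; apply: eq_bigr => j _; rewrite natrD addrA.
Qed.

Lemma state_kernel_variance : u - s + 1 != 0 ->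
  \sum_(n < N.+1) state_kernel C' s t k m n * (position t (A + n%:R)
    - ((u - t) * position s (A + k%:R) + (t - s) * position u (A + m%:R)) / (u - s)) ^+ 2
  = (t - s) * (u - t) / (u - s + 1)
    * (((position u (A + m%:R) - position s (A + k%:R)) / (u - s)) ^+ 2
       + (s * position u (A + m%:R) - u * position s (A + k%:R)) / (u - s)).
Proof.
move=> us1; rewrite (@sum_state_kernel _ _ _ _ _ (fun n => (position t (A + n%:R)
  - ((u - t) * position s (A + k%:R) + (t - s) * position u (A + m%:R)) / (u - s)) ^+ 2))
  ?km//.
rewrite -end_point -kernel_variance//; last first.
- by rewrite end_point -C'E.
- exact: start_gt0.
by rewrite end_point -C'E; apply: eq_bigr => j _; rewrite natrD addrA.
Qed.

End moments.

End state_kernel.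

(** * The transformed chain is a quadratic harness *)

Section process_sigma_algebra.
Context {R : realType} {d : measure_display} {T : measurableType d}.
Variables (Z : R -> T -> R) (I : set R).

Let generators := \bigcup_(r in I) g_sigma_algebra_preimage (Z r).

Definition observable (f : T -> R) :=
  measurable_fun (setT : set (g_sigma_algebraType generators)) f.

Lemma observable_process r : I r -> observable (Z r).
Proof.
by move=> Ir _ B mB; apply: sub_sigma_algebra; exists r => //; exists B.
Qed.

Lemma observable_cst (a : R) : observable (fun=> a).
Proof. exact: measurable_cst. Qed.

Lemma observableD f g :
  observable f -> observable g -> observable (fun w => f w + g w).
Proof. exact: measurable_funD. Qed.

Lemma observableN f : observable f -> observable (fun w => - f w).
Proof. exact: measurableT_comp. Qed.

Lemma observableM f g :
  observable f -> observable g -> observable (fun w => f w * g w).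
Proof. exact: measurable_funM. Qed.

Lemma observableX f n : observable f -> observable (fun w => f w ^+ n).
Proof. exact: measurable_funX. Qed.

Lemma observable_preimage f :
  observable f -> g_sigma_algebra_preimage f `<=` process_sigma Z I.
Proof. by move=> mf _ [B mB <-]; exact: mf. Qed.

Lemma process_sigma_coarse (xi : R -> T -> nat) (J : set R) (h : R -> R)
    (z : R -> nat -> R) :
  (forall r, I r -> J (h r)) -> (forall r, I r -> Z r = z r \o xi (h r)) ->
  process_sigma Z I `<=` process_sigma xi J.
Proof.
move=> IJ ZE; apply: smallest_sub; first exact: smallest_sigma_algebra.
move=> _ [r Ir [B mB <-]]; apply: sub_sigma_algebra; exists (h r); first exact: IJ.
by exists (z r @^-1` B) => //; rewrite (ZE r Ir).
Qed.

End process_sigma_algebra.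

Section racah_harness.
Context {R : realType} {d : measure_display} {T : measurableType d}.
Variables (P : probability T R) (N : nat) (A B C eps rho : R) (D D' : set R).
Variable xi : R -> T -> nat.

Let s0 := - (A + B).
Let E := B + C - N%:R.

Local Notation mob := (mobius A B C N%:R eps rho).
Local Notation den := (mobius_den B C N%:R eps rho).
Local Notation resc := (rescale A B C N%:R eps rho).
Local Notation eta := (eta_ A B C N%:R rho).
Local Notation theta := (theta_ A B C N%:R eps rho).
Local Notation sigma := (sigma_ B C N%:R eps).
Local Notation gamma := (gamma_ B C N%:R).
Local Notation prob := (pr P).
Local Notation at_ t n := [set w | xi t w = n].

Hypothesis chain : racah_chain P N A B C D xi.
Hypothesis AB : 0 < A - B + 1.
Hypothesis born : forall t, D t -> s0 < t.
Hypothesis regular : forall r, r = s0 \/ D r ->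
  forall i, (i < N)%N -> A - C + r + 1 + i%:R != 0.
Hypothesis eps1 : eps ^+ 2 = 1.
Hypothesis rho2 : rho ^+ 2 =
  eps * (E + 1) * (N%:R * (A + C) * (B + C) * (A - B + N%:R)).
Hypothesis rho_neq0 : rho != 0.
Hypothesis epsE_gt0 : 0 < eps * E.
Hypothesis epsE1_gt0 : 0 < eps * (E + 1).
Hypothesis D'_gt0 : forall tau, D' tau -> 0 < tau.
Hypothesis D'_den : forall tau, D' tau -> 0 < 1 + eps * tau.
Hypothesis D'D : forall tau, D' tau -> D (mob tau).

Let E_neq0 : E != 0.
Proof. by have := gt_eqF epsE_gt0; rewrite mulf_eq0 => /norP[]. Qed.

Let E1_neq0 : E + 1 != 0.
Proof. by have := gt_eqF epsE1_gt0; rewrite mulf_eq0 => /norP[]. Qed.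

Let mxi t : D t -> measurable_fun setT (xi t).
Proof. exact: chain_measurable chain t. Qed.

Let law t n : D t -> (n <= N)%N -> prob (at_ t n) = state_kernel A C s0 t 0 N n.
Proof.
move=> Dt nN; rewrite /state_kernel leq0n nN !subn0 addr0 /kernel.
have -> : - A - s0 + t / 2 = B + t / 2 by rewrite /s0; ring.
by rewrite /pr (chain_law chain Dt nN).
Qed.

Let transition s t : D s -> D t -> s < t ->
  forall k n, (k <= N)%N -> (n <= N)%N -> P (at_ s k) != 0%E ->
  cond_prob P (at_ t n) (at_ s k) = state_kernel A C s t k N n.
Proof.
move=> Ds Dt st k n kN nN Pk; rewrite (chain_transition chain Ds Dt st kN nN Pk).
rewrite /state_kernel nN andbT /kernel.
have -> : A + t / 2 + k%:R = A + k%:R + t / 2 by ring.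
by have -> : - A - s + t / 2 - k%:R = - (A + k%:R) - s + t / 2 by ring.
Qed.

(** The birth time is adjoined to the time set, as the image of [0]: with it,
    the one-dimensional laws are transitions and conditioning on the future is
    the bridge from the birth time. *)
Let T0 tau := tau = 0 \/ D' tau.

Let T0_den tau : T0 tau -> 0 < 1 + eps * tau.
Proof. by case=> [->|/D'_den//]; rewrite mulr0 addr0. Qed.

Let T0_den_neq0 tau : T0 tau -> 1 + eps * tau != 0.
Proof. by move=> /T0_den /gt_eqF ->. Qed.

Let den_neq0 tau : D' tau -> den tau != 0.
Proof.
move=> Dt; rewrite !mulf_neq0 ?invr_eq0 ?T0_den_neq0//; last by right.
by have := gt_eqF epsE_gt0; rewrite mulf_eq0 => /norP[].
Qed.

Let mob0 : mob 0 = s0.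
Proof.
by rewrite mobiusE ?mulr0 ?addr0 ?oner_eq0// mul0r mulr0 addr0.
Qed.

Let born_mob tau : T0 tau -> s0 <= mob tau.
Proof. by case=> [->|/D'D /born /ltW//]; rewrite mob0. Qed.

Let regular_mob tau : T0 tau -> forall i, (i < N)%N ->
  A - C + mob tau + 1 + i%:R != 0.
Proof.
by case=> [->|/D'D Dt]; [rewrite mob0|]; apply: regular; [left|right].
Qed.

Let mob_lt s t : T0 s -> T0 t -> s < t -> mob s < mob t.
Proof.
move=> Ts Tt st; rewrite -subr_gt0 mobius_sub ?T0_den_neq0//.
apply: divr_gt0; last by rewrite mulr_gt0 ?T0_den.
by rewrite pmulr_lgt0 ?subr_gt0// mulrC.
Qed.

Let zval tau n := resc tau (position (mob tau) (A + n%:R)).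

Let zval0 : zval 0 0 = 0.
Proof.
rewrite /zval /rescale mob0 /mean_position /position /s0.
by rewrite !mulr0 !addr0 divr1; ring.
Qed.

Let zval_sum (K : nat -> R) tau mu :
  \sum_(n < N.+1) K n = 1 ->
  \sum_(n < N.+1) K n * position (mob tau) (A + n%:R) = mu ->
  \sum_(n < N.+1) K n * zval tau n = resc tau mu.
Proof.
move=> K1 Kmu; rewrite /zval /rescale.
under eq_bigr => n _ do rewrite mulrCA mulrBr.
by rewrite -mulr_sumr sumrB Kmu -mulr_suml K1 mul1r.
Qed.

Let zval_sum_sqr (K : nat -> R) tau mu :
  \sum_(n < N.+1) K n * (zval tau n - resc tau mu) ^+ 2
  = den tau ^+ 2 * \sum_(n < N.+1) K n * (position (mob tau) (A + n%:R) - mu) ^+ 2.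
Proof.
rewrite mulr_sumr; apply: eq_bigr => n _.
by rewrite /zval /rescale; ring.
Qed.

Let bridge_mean (s t u zs zu : R) := (u - t) / (u - s) * zs + (t - s) / (u - s) * zu.

Let bridge_var (s t u zs zu : R) :=
  (u - t) * (t - s) / (u * (1 + sigma * s) + sigma - gamma * s)
    * (1 + eta * ((u * zs - s * zu) / (u - s)) + theta * ((zu - zs) / (u - s))
       + sigma * ((u * zs - s * zu) ^+ 2 / (u - s) ^+ 2)
       + sigma * ((zu - zs) ^+ 2 / (u - s) ^+ 2)
       - (1 - gamma) * ((zu - zs) * (u * zs - s * zu) / (u - s) ^+ 2)).

Let past_var (s t z : R) := (t - s) / (1 + sigma * s) * (sigma * z ^+ 2 + eta * z + 1).

Let bridge_kernel s t u k m := state_kernel A (mob u + (A + m%:R)) (mob s) (mob t) k m.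

Let bridge_moments s t u k m : T0 s -> T0 t -> T0 u -> s < t -> t < u ->
  (m <= N)%N -> \sum_(n < N.+1) bridge_kernel s t u k m n = 1 ->
  \sum_(n < N.+1) bridge_kernel s t u k m n * zval t n
    = bridge_mean s t u (zval s k) (zval u m)
  /\ \sum_(n < N.+1) bridge_kernel s t u k m n
       * (zval t n - bridge_mean s t u (zval s k) (zval u m)) ^+ 2
    = bridge_var s t u (zval s k) (zval u m).
Proof.
move=> Ts Tt Tu st tu mN total.
have su := lt_trans st tu.
have us_neq0 : u - s != 0 by rewrite subr_eq0 gt_eqF.
have msu := mob_lt Ts Tu su; have mtu := mob_lt Tt Tu tu.
have mus_neq0 : mob u - mob s != 0 by rewrite subr_eq0 gt_eqF.
have mus1_neq0 : mob u - mob s + 1 != 0.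
  by rewrite gt_eqF// addr_gt0// subr_gt0.
have absorb i : (i < m - k)%N ->
    A + k%:R - (mob u + (A + m%:R)) + mob t + 1 + i%:R != 0.
  move=> im; rewrite lt_eqF//.
  have : i.+1%:R + k%:R <= m%:R :> R by rewrite -natrD ler_nat addSn addnC -ltn_subRL.
  by move: mtu; rewrite -natr1; lra.
have mean := state_kernel_mean AB (erefl _) (born_mob Ts) (born_mob Tt)
  mus_neq0 mN absorb total.
have var := state_kernel_variance AB (erefl _) (born_mob Ts) (born_mob Tt)
  mus_neq0 mN absorb total mus1_neq0.
have mean' := zval_sum total mean.
have meanE : resc t (((mob u - mob t) * position (mob s) (A + k%:R)
    + (mob t - mob s) * position (mob u) (A + m%:R)) / (mob u - mob s))
  = bridge_mean s t u (zval s k) (zval u m).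
  by rewrite (@rescale_bridge_mean _ _ _ _ _ _ _ eps1)// ?T0_den_neq0.
split; first by rewrite -meanE.
rewrite -meanE zval_sum_sqr var.
by rewrite (@rescale_bridge_variance _ _ _ _ _ _ _ eps1 rho2)// ?T0_den_neq0.
Qed.

Let past_moments s t k : T0 s -> T0 t -> s < t -> (k <= N)%N ->
  let K := state_kernel A C (mob s) (mob t) k N in
  \sum_(n < N.+1) K n = 1 ->
  \sum_(n < N.+1) K n * zval t n = zval s k
  /\ \sum_(n < N.+1) K n * (zval t n - zval s k) ^+ 2 = past_var s t (zval s k).
Proof.
move=> Ts Tt st kN K total; set t1 := C - A - N%:R.
have sn := T0_den_neq0 Ts; have tn := T0_den_neq0 Tt.
have CE : C = t1 + (A + N%:R) by rewrite /t1; ring.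
have end_sub : t1 - mob s = E / (1 + eps * s).
  by apply: mobius_end_sub.
have mus_neq0 : t1 - mob s != 0.
  by rewrite end_sub mulf_neq0// invr_eq0.
have mus1_neq0 : t1 - mob s + 1 != 0.
  rewrite end_sub (_ : _ + 1 = (E + 1 + eps * s) / (1 + eps * s)).
    rewrite mulf_neq0 ?invr_eq0//.
    have : 0 < eps * (E + 1 + eps * s).
      rewrite mulrDr mulrA -expr2 eps1 mul1r ltr_wpDr//.
      by case: Ts => [->//|/D'_gt0/ltW].
    by move=> /gt_eqF; rewrite mulf_eq0 => /norP[].
  by field.
have absorb i : (i < N - k)%N -> A + k%:R - C + mob t + 1 + i%:R != 0.
  move=> ik; have -> : A + k%:R - C + mob t + 1 + i%:R
      = A - C + mob t + 1 + (k + i)%:R by rewrite natrD; ring.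
  by apply: regular_mob; rewrite // -ltn_subRL.
have y1E : position t1 (A + N%:R) = (A + N%:R) * C.
  by rewrite /position /t1; ring.
have mean := state_kernel_mean AB CE (born_mob Ts) (born_mob Tt)
  mus_neq0 (leqnn N) absorb total.
have var := state_kernel_variance AB CE (born_mob Ts) (born_mob Tt)
  mus_neq0 (leqnn N) absorb total mus1_neq0.
have mean' := zval_sum total mean.
rewrite y1E in mean mean' var.
have meanE : resc t (((t1 - mob t) * position (mob s) (A + k%:R)
    + (mob t - mob s) * ((A + N%:R) * C)) / (t1 - mob s)) = zval s k.
  by rewrite /t1 rescale_past_mean.
split; first by rewrite -meanE.
rewrite -meanE zval_sum_sqr var meanE.
by rewrite /t1 rescale_past_variance.
Qed.

Section process.
Variable Z : R -> T -> R.
Hypothesis ZE : forall tau, D' tau -> forall w, Z tau w = zval tau (xi (mob tau) w).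
Hypothesis D'_domain : [/\ open D', is_interval D' & D' `<=` [set t | 0 < t]].

Let state t w : 'I_N.+1 := inord (xi t w).

Let stateE t w : D t -> state t w = xi t w :> nat.
Proof. by move=> Dt; rewrite inordK// ltnS (chain_states chain Dt). Qed.

Let state_fiber t (n : 'I_N.+1) : D t -> state t @^-1` [set n] = at_ t n.
Proof.
move=> Dt; apply/seteqP; split=> w /=; first by move=> <-; rewrite stateE.
by move=> xn; apply: val_inj; rewrite /= stateE.
Qed.

Let mstate t (n : 'I_N.+1) : D t -> measurable (state t @^-1` [set n]).
Proof. by move=> Dt; rewrite state_fiber//; exact: (measurable_state mxi). Qed.

Let ZstateE tau : D' tau -> Z tau = (fun n : 'I_N.+1 => zval tau n) \o state (mob tau).
Proof.
by move=> Dt; apply/funext => w; rewrite /= stateE ?ZE//; exact: D'D.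
Qed.

Let Z_coarse (I J : set R) : I `<=` D' ->
  (forall r, I r -> J (mob r)) -> process_sigma Z I `<=` process_sigma xi J.
Proof.
move=> ID IJ; apply: (process_sigma_coarse IJ (z := zval)) => r Ir.
by apply/funext => w; rewrite ZE//; exact: ID.
Qed.

Let Z_measurable (I : set R) : I `<=` D' -> process_sigma Z I `<=` measurable.
Proof.
move=> ID; apply: subset_trans (process_sigma_measurable mxi (@subset_refl _ D)).
by apply: Z_coarse => // r /ID/D'D.
Qed.

Let Z_integrable tau : D' tau -> P.-integrable setT (EFin \o Z tau).
Proof.
move=> Dt; rewrite ZstateE//; apply: integrable_finite_valued => n.
by apply: mstate; exact: D'D.
Qed.

Let expectation_state t (f : nat -> R) mu : D t ->
  (\sum_(n < N.+1) state_kernel A C s0 t 0 N n = 1 ->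
   \sum_(n < N.+1) state_kernel A C s0 t 0 N n * f n = mu) ->
  ('E_P[fun w => f (xi t w)] = mu%:E)%E.
Proof.
move=> Dt fmu; rewrite unlock.
have fiberT : (fun _ : T => tt) @^-1` [set tt] = setT.
  by apply/seteqP; split.
have mtt (c : unit) : measurable ((fun _ : T => tt) @^-1` [set c]).
  by case: c; rewrite fiberT.
have := @integral_kernel _ _ _ P unit 'I_N.+1 (fun=> tt) (state t)
  mtt (fun n => mstate n Dt)
  (fun _ n => state_kernel A C s0 t 0 N n) (fun _ n => f n) (fun=> mu)
  (fun=> fmu) setT measurableT.
rewrite integral_cst//= probability_setT mule1 => ->.
  by apply: eq_integral => w _; rewrite stateE.
move=> [] n; rewrite fiberT !setTI state_fiber// law//; last by rewrite -ltnS.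
by rewrite /pr probability_setT mul1r.
Qed.

Let past (s : R) := [set r | D' r /\ r <= s].
Let future u := [set r | D' r /\ u <= r].
Let outside s u := [set r | D' r /\ (r <= s \/ u <= r)].

Let mob_le s t : D' s -> D' t -> s <= t -> mob s <= mob t.
Proof.
move=> Ds Dt; rewrite le_eqVlt => /predU1P[->//|st].
by apply/ltW/mob_lt => //; right.
Qed.

Let past_coarse s : D' s ->
  process_sigma Z (past s) `<=` process_sigma xi [set r | D r /\ r <= mob s].
Proof.
move=> Ds; apply: Z_coarse => [r []//|r [Dr rs]].
by split; [exact: D'D|exact: mob_le].
Qed.

Let future_coarse u : D' u ->
  process_sigma Z (future u) `<=` process_sigma xi [set r | D r /\ mob u <= r].
Proof.
move=> Du; apply: Z_coarse => [r []//|r [Dr ur]].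
by split; [exact: D'D|exact: mob_le].
Qed.

Let outside_coarse s u : D' s -> D' u ->
  process_sigma Z (outside s u)
  `<=` process_sigma xi [set r | D r /\ (r <= mob s \/ mob u <= r)].
Proof.
move=> Ds Du; apply: Z_coarse => [r []//|r [Dr rsu]].
by split; [exact: D'D|case: rsu => [rs|ur]; [left|right]; exact: mob_le].
Qed.

Let past_law' s t k n H : D' s -> D' t -> s < t -> (k <= N)%N -> (n <= N)%N ->
  process_sigma Z (past s) H ->
  prob (H `&` at_ (mob s) k `&` at_ (mob t) n)
  = prob (H `&` at_ (mob s) k) * state_kernel A C (mob s) (mob t) k N n.
Proof.
move=> Ds Dt st kN nN /(past_coarse Ds) sH.
apply: (past_law mxi (chain_markov chain) transition) => //; try exact: D'D.
by apply: mob_lt => //; right.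
Qed.

Let step_bridge s t u k n m : T0 s -> T0 t -> T0 u -> s < t -> t < u ->
  (m <= N)%N ->
  state_kernel A C (mob s) (mob t) k N n * state_kernel A C (mob t) (mob u) n N m
  = state_kernel A C (mob s) (mob u) k N m * bridge_kernel s t u k m n.
Proof.
move=> Ts Tt Tu st tu mN; apply: (state_kernel_bridge AB k n) => //.
- exact: born_mob.
- exact: mob_lt.
- exact: mob_lt.
- by move=> r; rewrite !inE => /or3P[] /eqP ->; exact: regular_mob.
Qed.

Let T0_0 : T0 0. Proof. by left. Qed.

Let T0_D' tau : D' tau -> T0 tau. Proof. by right. Qed.

Let future_law' t u n m H : D' t -> D' u -> t < u -> (n <= N)%N -> (m <= N)%N ->
  process_sigma Z (future u) H ->
  prob (H `&` at_ (mob u) m `&` at_ (mob t) n)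
  = prob (H `&` at_ (mob u) m) * bridge_kernel 0 t u 0 m n.
Proof.
move=> Dt Du tu nN mN /(future_coarse Du) sH.
have mtu : mob t < mob u by apply: mob_lt => //; exact: T0_D'.
apply: (future_law mxi (chain_markov chain)) sH _ => //; try exact: D'D.
have := past_law mxi (chain_markov chain) transition (D'D Dt) (D'D Du) mtu nN mN
  (@process_sigmaT _ _ _ xi _).
rewrite setTI => ->; rewrite law//; last exact: D'D.
rewrite law//; last exact: D'D.
rewrite -mob0; apply: step_bridge => //; try exact: T0_D'.
exact: D'_gt0.
Qed.

Let bridge_law' s t u k n m H : D' s -> D' t -> D' u -> s < t -> t < u ->
  (k <= N)%N -> (n <= N)%N -> (m <= N)%N ->
  process_sigma Z (outside s u) H ->
  prob (H `&` (at_ (mob s) k `&` at_ (mob u) m) `&` at_ (mob t) n)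
  = prob (H `&` (at_ (mob s) k `&` at_ (mob u) m)) * bridge_kernel s t u k m n.
Proof.
move=> Ds Dt Du st tu kN nN mN /(outside_coarse Ds Du) sH.
apply: (bridge_law mxi (chain_markov chain) transition) sH => //; try exact: D'D.
- by apply: mob_lt => //; exact: T0_D'.
- by apply: mob_lt => //; exact: T0_D'.
- by apply: step_bridge => //; exact: T0_D'.
Qed.

Let past_cond s t (f : nat -> nat -> R) (g : nat -> R) X Y :
  D' s -> D' t -> s < t ->
  (forall w, X w = f (xi (mob s) w) (xi (mob t) w)) ->
  (forall w, Y w = g (xi (mob s) w)) ->
  (forall k, (k <= N)%N -> let K := state_kernel A C (mob s) (mob t) k N in
     \sum_(n < N.+1) K n = 1 -> \sum_(n < N.+1) K n * f k n = g k) ->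
  observable Z (past s) Y ->
  is_cond_exp P (process_sigma Z (past s)) X Y.
Proof.
move=> Ds Dt st XE YE fg /observable_preimage obs.
have mk (k : 'I_N.+1) := mstate k (D'D Ds).
have mn (n : 'I_N.+1) := mstate n (D'D Dt).
apply: (is_cond_exp_kernel mk mn (q := fun k n : 'I_N.+1 =>
    state_kernel A C (mob s) (mob t) k N n)
  (f := fun k n : 'I_N.+1 => f k n) (g := fun k : 'I_N.+1 => g k)) => //.
- by move=> k; apply: fg; rewrite -ltnS.
- by apply: Z_measurable => r [].
- by move=> w; rewrite XE !stateE//; exact: D'D.
- by move=> w; rewrite YE stateE//; exact: D'D.
- move=> H sH k n; rewrite !state_fiber; try exact: D'D.
  by apply: past_law' => //; rewrite -ltnS.
Qed.

Let future_cond t u (f : nat -> nat -> R) (g : nat -> R) X Y :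
  D' t -> D' u -> t < u ->
  (forall w, X w = f (xi (mob u) w) (xi (mob t) w)) ->
  (forall w, Y w = g (xi (mob u) w)) ->
  (forall m, (m <= N)%N -> let K := bridge_kernel 0 t u 0 m in
     \sum_(n < N.+1) K n = 1 -> \sum_(n < N.+1) K n * f m n = g m) ->
  observable Z (future u) Y ->
  is_cond_exp P (process_sigma Z (future u)) X Y.
Proof.
move=> Dt Du tu XE YE fg /observable_preimage obs.
have mm (m : 'I_N.+1) := mstate m (D'D Du).
have mn (n : 'I_N.+1) := mstate n (D'D Dt).
apply: (is_cond_exp_kernel mm mn (q := fun m n : 'I_N.+1 => bridge_kernel 0 t u 0 m n)
  (f := fun m n : 'I_N.+1 => f m n) (g := fun m : 'I_N.+1 => g m)) => //.
- by move=> m; apply: fg; rewrite -ltnS.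
- by apply: Z_measurable => r [].
- by move=> w; rewrite XE !stateE//; exact: D'D.
- by move=> w; rewrite YE stateE//; exact: D'D.
- move=> H sH m n; rewrite !state_fiber; try exact: D'D.
  by apply: future_law' => //; rewrite -ltnS.
Qed.

Let bridge_cond s t u (f : nat * nat -> nat -> R) (g : nat * nat -> R) X Y :
  D' s -> D' t -> D' u -> s < t -> t < u ->
  (forall w, X w = f (xi (mob s) w, xi (mob u) w) (xi (mob t) w)) ->
  (forall w, Y w = g (xi (mob s) w, xi (mob u) w)) ->
  (forall k m, (m <= N)%N -> let K := bridge_kernel s t u k m in
     \sum_(n < N.+1) K n = 1 -> \sum_(n < N.+1) K n * f (k, m) n = g (k, m)) ->
  observable Z (outside s u) Y ->
  is_cond_exp P (process_sigma Z (outside s u)) X Y.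
Proof.
move=> Ds Dt Du st tu XE YE fg /observable_preimage obs.
pose both w := (state (mob s) w, state (mob u) w).
have bothE c : both @^-1` [set c] = at_ (mob s) c.1 `&` at_ (mob u) c.2.
  rewrite -!state_fiber; try exact: D'D.
  by case: c => k m; apply/seteqP; split=> w /= => [[-> ->]|[<- <-]].
have mb c : measurable (both @^-1` [set c]).
  rewrite bothE; apply: measurableI; apply: (measurable_state mxi); exact: D'D.
have mn (n : 'I_N.+1) := mstate n (D'D Dt).
apply: (is_cond_exp_kernel mb mn
  (q := fun (c : 'I_N.+1 * 'I_N.+1) (n : 'I_N.+1) => bridge_kernel s t u c.1 c.2 n)
  (f := fun c n => f (c.1 : nat, c.2 : nat) n)
  (g := fun c => g (c.1 : nat, c.2 : nat))) => //.
- by move=> [k m]; apply: fg; rewrite -ltnS.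
- by apply: Z_measurable => r [].
- by move=> w; rewrite XE !stateE//; exact: D'D.
- by move=> w; rewrite YE !stateE//; exact: D'D.
- move=> H sH c n; rewrite bothE state_fiber; last exact: D'D.
  by apply: bridge_law' => //; rewrite -ltnS.
Qed.

Let observe I r : I r -> observable Z I (Z r).
Proof. exact: observable_process. Qed.

Let past_mean_cond s t : D' s -> D' t -> s < t ->
  is_cond_exp P (process_sigma Z (past s)) (Z t) (Z s).
Proof.
move=> Ds Dt st.
apply: (past_cond (s := s) (t := t) (f := fun _ => zval t) (g := zval s)) => //.
- exact: ZE.
- exact: ZE.
- by move=> k kN K K1; apply: (past_moments _ _ _ _ K1).1 => //; exact: T0_D'.
by apply: observe; split.
Qed.

Let past_var_cond s t : D' s -> D' t -> s < t ->
  is_cond_var P (process_sigma Z (past s)) (Z t)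
    (fun w => past_var s t (Z s w)).
Proof.
move=> Ds Dt st; exists (Z s); first exact: past_mean_cond.
apply: (past_cond (t := t) (f := fun k n => (zval t n - zval s k) ^+ 2)
  (g := fun k => past_var s t (zval s k))) => //.
- by move=> w; rewrite !ZE.
- by move=> w; rewrite !ZE.
- by move=> k kN K K1; apply: (past_moments _ _ _ _ K1).2 => //; exact: T0_D'.
have obs : observable Z (past s) (Z s) by apply: observe; split.
rewrite /past_var; do ?[exact: obs | exact: observable_cst | apply: observableD
  | apply: observableM | apply: observableX].
Qed.

Let bridge_var_observable I s t u f g : observable Z I f -> observable Z I g ->
  observable Z I (fun w => bridge_var s t u (f w) (g w)).
Proof.
move=> obsf obsg; rewrite /bridge_var; do ?[exact: obsf | exact: obsg
  | exact: observable_cst | apply: observableD | apply: observableN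
  | apply: observableM | apply: observableX].
Qed.

Let bridge_mean_cond s t u : D' s -> D' t -> D' u -> s < t -> t < u ->
  is_cond_exp P (process_sigma Z (outside s u)) (Z t)
    (fun w => bridge_mean s t u (Z s w) (Z u w)).
Proof.
move=> Ds Dt Du st tu.
apply: (bridge_cond (t := t) (f := fun _ => zval t)
  (g := fun c => bridge_mean s t u (zval s c.1) (zval u c.2))) => //.
- exact: ZE.
- by move=> w; rewrite !ZE.
- by move=> k m mN K K1; apply: (bridge_moments _ _ _ _ _ _ K1).1 => //; exact: T0_D'.
have obss : observable Z (outside s u) (Z s) by apply: observe; split => //; left.
have obsu : observable Z (outside s u) (Z u) by apply: observe; split => //; right.
rewrite /bridge_mean; do ?[exact: obss | exact: obsu | exact: observable_cst
  | apply: observableD | apply: observableM].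
Qed.

Let bridge_var_cond s t u : D' s -> D' t -> D' u -> s < t -> t < u ->
  is_cond_var P (process_sigma Z (outside s u)) (Z t)
    (fun w => bridge_var s t u (Z s w) (Z u w)).
Proof.
move=> Ds Dt Du st tu.
exists (fun w => bridge_mean s t u (Z s w) (Z u w)); first exact: bridge_mean_cond.
apply: (bridge_cond (t := t) (f := fun c n =>
    (zval t n - bridge_mean s t u (zval s c.1) (zval u c.2)) ^+ 2)
  (g := fun c => bridge_var s t u (zval s c.1) (zval u c.2))) => //.
- by move=> w; rewrite !ZE.
- by move=> w; rewrite !ZE.
- by move=> k m mN K K1; apply: (bridge_moments _ _ _ _ _ _ K1).2 => //; exact: T0_D'.
by apply: bridge_var_observable; apply: observe; split => //; [left|right].
Qed.

Let future_mean_cond t u : D' t -> D' u -> t < u ->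
  is_cond_exp P (process_sigma Z (future u)) (Z t)
    (fun w => bridge_mean 0 t u 0 (Z u w)).
Proof.
move=> Dt Du tu.
apply: (future_cond (t := t) (f := fun _ => zval t)
  (g := fun m => bridge_mean 0 t u 0 (zval u m))) => //.
- exact: ZE.
- by move=> w; rewrite ZE.
- move=> m mN K K1.
  by have := (bridge_moments T0_0 (T0_D' Dt) (T0_D' Du) (D'_gt0 Dt) tu mN K1).1;
    rewrite zval0.
have obs : observable Z (future u) (Z u) by apply: observe; split.
rewrite /bridge_mean; do ?[exact: obs | exact: observable_cst
  | apply: observableD | apply: observableM].
Qed.

Let future_var_cond t u : D' t -> D' u -> t < u ->
  is_cond_var P (process_sigma Z (future u)) (Z t)
    (fun w => bridge_var 0 t u 0 (Z u w)).
Proof.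
move=> Dt Du tu.
exists (fun w => bridge_mean 0 t u 0 (Z u w)); first exact: future_mean_cond.
apply: (future_cond (t := t) (f := fun m n =>
    (zval t n - bridge_mean 0 t u 0 (zval u m)) ^+ 2)
  (g := fun m => bridge_var 0 t u 0 (zval u m))) => //.
- by move=> w; rewrite !ZE.
- by move=> w; rewrite ZE.
- move=> m mN K K1.
  by have := (bridge_moments T0_0 (T0_D' Dt) (T0_D' Du) (D'_gt0 Dt) tu mN K1).2;
    rewrite zval0.
by apply: bridge_var_observable; [exact: observable_cst|apply: observe; split].
Qed.

(** When [s = t] or [t = u] the conditional statements degenerate to the
    identity, as [Z t] is then observable; otherwise they are the moments of the
    three conditional laws. *)
Lemma racah_harness : quadratic_harness P D' Z eta theta sigma sigma gamma.
Proof.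
have self I X : observable Z I X -> P.-integrable setT (EFin \o X) ->
  is_cond_exp P (process_sigma Z I) X X.
  by move=> /observable_preimage obs iX; split.
have const0 I : is_cond_exp P (process_sigma Z I) (fun=> 0) (fun=> 0).
  apply: self; first exact: observable_cst.
  by apply: (@eq_integrable _ _ _ _ _ _ (cst 0%E)) => //; exact: integrable0.
have second_moment t : D' t -> ('E_P[fun w => (Z t w ^+ 2)%R] = t%:E)%E.
  move=> Dt; under eq_fun do rewrite ZE//.
  apply: (expectation_state (f := fun n => zval t n ^+ 2)); first exact: D'D.
  move=> K1; have := (past_moments T0_0 (T0_D' Dt) (D'_gt0 Dt) (leq0n N)).
  rewrite mob0 zval0 => /(_ K1)[_]; under eq_bigr do rewrite subr0.
  by move=> ->; rewrite /past_var; field.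
split => //.
- move=> t Dt; rewrite ZstateE//.
  by apply: Lfun2_finite_valued => n; apply: mstate; exact: D'D.
- move=> t Dt; rewrite (_ : Z t = fun w => zval t (xi (mob t) w)); last first.
    by apply/funext; exact: ZE.
  apply: (expectation_state (f := zval t)); first exact: D'D.
  move=> K1; have := (past_moments T0_0 (T0_D' Dt) (D'_gt0 Dt) (leq0n N)).
  by rewrite mob0 zval0 => /(_ K1)[].
- move=> s t; wlog : s t / s <= t.
    move=> main Ds Dt; have [st|/ltW ts] := leP s t.
      by have := main s t st Ds Dt; rewrite (min_idPl st).
    have := main t s ts Dt Ds; rewrite (min_idPl ts) => <-.
    by congr expectation; apply/funext => w; rewrite mulrC.
  move=> st Ds Dt; move: st; rewrite le_eqVlt => /predU1P[<-|st].
    by rewrite minxx -second_moment.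
  rewrite (min_idPl (ltW st)) -second_moment// unlock.
  have mk (k : 'I_N.+1) := mstate k (D'D Ds).
  have mn (n : 'I_N.+1) := mstate n (D'D Dt).
  transitivity (\int[P]_w (zval s (state (mob s) w)
      * zval t (state (mob t) w))%:E)%E.
    by apply: eq_integral => w _; rewrite !ZE// !stateE//; exact: D'D.
  transitivity (\int[P]_w (zval s (state (mob s) w) ^+ 2)%:E)%E; last first.
    by apply: eq_integral => w _; rewrite !ZE// !stateE//; exact: D'D.
  symmetry; apply: (integral_kernel (P := P) mk mn
    (q := fun k n : 'I_N.+1 => state_kernel A C (mob s) (mob t) k N n)
    (f := fun k n : 'I_N.+1 => zval s k * zval t n)
    (g := fun k : 'I_N.+1 => zval s k ^+ 2)) => // [|k n].
    move=> k K1; under eq_bigr do rewrite mulrCA.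
    rewrite -mulr_sumr expr2; congr (_ * _).
    apply: (past_moments _ _ _ _ K1).1 => //; last by rewrite -ltnS.
    - exact: T0_D'.
    - exact: T0_D'.
  rewrite !state_fiber; try exact: D'D.
  apply: past_law' => //; [by rewrite -ltnS|by rewrite -ltnS|].
  exact: (@measurableT _ (g_sigma_algebraType _)).
- move=> t u Dt Du; rewrite le_eqVlt => /predU1P[tu|tu].
    subst u; rewrite (_ : (fun w => t / t * Z t w) = Z t); last first.
      by apply/funext => w; rewrite divff ?mul1r// gt_eqF// D'_gt0.
    by apply: self; [apply: observe; split|exact: Z_integrable].
  rewrite (_ : (fun w => t / u * Z u w)
      = (fun w => bridge_mean 0 t u 0 (Z u w))); last first.
    by apply/funext => w; rewrite /bridge_mean !subr0 mulr0 add0r.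
  exact: future_mean_cond.
- move=> s t Ds Dt; rewrite le_eqVlt => /predU1P[<-|]; last exact: past_mean_cond.
  by apply: self; [apply: observe; split|exact: Z_integrable].
- move=> s t Ds Dt; rewrite le_eqVlt => /predU1P[<-|]; last exact: past_var_cond.
  exists (Z s); first by apply: self; [apply: observe; split|exact: Z_integrable].
  rewrite [X in is_cond_exp _ _ X _](_ : _ = fun=> 0); last first.
    by apply/funext => w; rewrite subrr expr0n.
  rewrite [X in is_cond_exp _ _ _ X](_ : _ = fun=> 0)//.
  by apply/funext => w; rewrite subrr !mul0r.
- move=> t u Dt Du; rewrite le_eqVlt => /predU1P[tu|tu].
    subst u; exists (Z t).
      by apply: self; [apply: observe; split|exact: Z_integrable].
    rewrite [X in is_cond_exp _ _ X _](_ : _ = fun=> 0); last first.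
      by apply/funext => w; rewrite subrr expr0n.
    rewrite [X in is_cond_exp _ _ _ X](_ : _ = fun=> 0)//.
    by apply/funext => w; rewrite subrr mulr0 !mul0r.
  rewrite [X in is_cond_var _ _ _ X](_ : _ = (fun w => bridge_var 0 t u 0 (Z u w))).
    exact: future_var_cond.
  apply/funext => w; rewrite /bridge_var; set z := Z u w.
  have u_neq0 : u != 0 by rewrite gt_eqF// D'_gt0.
  have -> : u * (1 + sigma * 0) + sigma - gamma * 0 = u + sigma by ring.
  congr (_ / _ * _); first by ring.
  by field.
Qed.

(** At the birth time the rescaled process is [0], so the mean of the rescaled
    process vanishes at all times. *)
Lemma expectation_harness_process tau : D' tau ->
  ('E_P[harness_process A xi (mob tau)]
   = (mean_position A B C N%:R eps tau)%:E)%E.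
Proof.
move=> Dt; rewrite (_ : harness_process A xi (mob tau)
    = fun w => position (mob tau) (A + (xi (mob tau) w)%:R)); last first.
  by apply/funext => w; rewrite /harness_process /position; ring.
apply: (expectation_state (f := fun n => position (mob tau) (A + n%:R))).
  exact: D'D.
move=> K1; have := (past_moments T0_0 (T0_D' Dt) (D'_gt0 Dt) (leq0n N)).
rewrite mob0 zval0 => /(_ K1)[mean0 _].
have := @zval_sum (state_kernel A C s0 (mob tau) 0 N) tau _ K1 (erefl _).
rewrite mean0 => /esym/eqP.
by rewrite mulf_eq0 (negbTE (den_neq0 Dt)) subr_eq0 => /eqP.
Qed.

End process.

Lemma racah_transformable :
  [/\ open D', is_interval D' & D' `<=` [set t | 0 < t]] ->
  (forall r, D r -> C - A - N%:R - r != 0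
     /\ D' (eps * (r - s0) / (C - A - N%:R - r))) ->
  transformable_to_harness P D (harness_process A xi) D' eta theta sigma sigma gamma.
Proof.
move=> D'_domain onto.
exists (mobius_num A B C N%:R eps rho), den; split.
- exists (eps * (E + 1) / rho * (eps * (C - A - N%:R))).
  exists (eps * (E + 1) / rho * s0) => tau.
  by rewrite /mobius_num /s0 /E; ring.
- exists (eps * (E + 1) / rho * eps); exists (eps * (E + 1) / rho) => tau.
  by rewrite /mobius_den /E; ring.
- by move=> tau; exact: den_neq0.
- split; first by move=> tau /D'D.
    move=> s t; rewrite !inE => Ds Dt eq_mob.
    have Ts : T0 s by right.
    have Tt : T0 t by right.
    by have [st|ts|//] := ltgtP s t; [have := mob_lt Ts Tt st|have := mob_lt Tt Ts ts];
      rewrite /mobius eq_mob ltxx.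
  move=> r /onto[t1r Dtau]; exists (eps * (r - s0) / (C - A - N%:R - r)) => //.
  exact: mobius_inv.
- apply: racah_harness => // tau Dt w.
  rewrite /= -/(mob tau) expectation_harness_process//= /zval /rescale.
  by rewrite /harness_process /position; ring.
Qed.

End racah_harness.

(** * The two cases *)

Unset Implicit Arguments.

Theorem theorem2p5 (R : realType) (d : measure_display) (T : measurableType d)
    (P : probability T R) (N : nat) (A B C : R) (xi : R -> T -> nat)
    (hN : (1 <= N)%N) (hA : - 2^-1 < A) (hB : - A < B < A + 1) :
  (* Case 1. The condition at N = 1 says that sigma is defined and positive;
     for N >= 2 this follows from the other hypotheses. *)
  (C < - A - N%:R + 1 -> (N = 1%N -> B + C < 0) ->
   racah_chain P N A B C `]- (A + B), +oo[%classic xi ->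
   let rho := Num.sqrt (N%:R * (A + C) * (B + C) * (A - B + N%:R)
                        * (N%:R - 1 - B - C)) in
   let eta := - ((A * (B + C + N%:R) + C * (B + C) + N%:R * (N%:R - B))
                 / rho) in
   let theta := - ((A * (B + C + N%:R) - B * (B + C - N%:R) + 2 * C * N%:R)
                   / rho) in
   let sigma := (N%:R - 1 - B - C)^-1 in
   let tau := sigma in
   let gamma := 1 + 2 * Num.sqrt (sigma * tau) in
   gamma = (B + C - N%:R - 1) / (B + C - N%:R + 1) /\
   transformable_to_harness P `]- (A + B), +oo[%classic (harness_process A xi)
     `]0, 1[%classic eta theta sigma tau gamma)
  /\
  (* Case 2 *)
  (A + N%:R < C ->
   racah_chain P N A B C `]- (A + B), C - A - N%:R[%classic xi ->
   let rho := Num.sqrt (N%:R * (A + C) * (B + C) * (A - B + N%:R)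
                        * (B + C - N%:R + 1)) in
   let eta := - ((A * (B + C + N%:R) + C * (B + C) + N%:R * (N%:R - B))
                 / rho) in
   let theta := (A * (B + C + N%:R) - B * (B + C - N%:R) + 2 * C * N%:R)
                / rho in
   let sigma := (B + C - N%:R + 1)^-1 in
   let tau := sigma in
   let gamma := 1 - 2 * Num.sqrt (sigma * tau) in
   gamma = (B + C - N%:R - 1) / (B + C - N%:R + 1) /\
   transformable_to_harness P `]- (A + B), C - A - N%:R[%classic
     (harness_process A xi)
     `]0, +oo[%classic eta theta sigma tau gamma).
Proof.
move: hA hB => A_gt /andP[B_gt B_lt].
have AB : 0 < A - B + 1 by lra.
have N1 : 1 <= N%:R :> R by rewrite ler1n.
split.
- move=> C_lt C_lt1 chain.
  have N2 : N = 1%N \/ 2 <= N%:R :> R.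
    have [N1'|N1'] := leqP N 1; last by right; rewrite ler_nat.
    by left; apply/eqP; rewrite eqn_leq N1' hN.
  have BC : B + C < 0.
    by case: N2 => [/C_lt1//|N2]; lra.
  (* For [N = 1] the hypotheses on [A], [B] and [C] only give [B + C < 1]; the
     extra condition is what makes [B + C - N + 1 = B + C] negative. *)
  have E1_lt0 : B + C - N%:R + 1 < 0.
    case: N2 => [N1'|N2]; last by lra.
    by have := C_lt1 N1'; rewrite N1'; lra.
  move=> rho eta theta sigma tau gamma.
  set s0 := - (A + B); set t1 := C - A - N%:R.
  have K_gt0 : 0 < N%:R * (A + C) * (B + C) * (A - B + N%:R) * (N%:R - 1 - B - C).
    rewrite mulr_gt0//; last by lra.
    rewrite mulr_gt0//; last by lra.
    rewrite -mulrA; apply: mulr_gt0; first by lra.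
    by rewrite nmulr_rgt0; lra.
  have rho2 : rho ^+ 2 = -1 * (B + C - N%:R + 1)
      * (N%:R * (A + C) * (B + C) * (A - B + N%:R)).
    by rewrite sqr_sqrtr ?ltW//; ring.
  have rho_neq0 : rho != 0 by rewrite gt_eqF// sqrtr_gt0.
  have sigmaE : sigma = sigma_ B C N%:R (-1).
    by rewrite /sigma /sigma_ mulN1r -invrN; congr (_^-1); ring.
  have sigma_gt0 : 0 < sigma by rewrite invr_gt0; lra.
  have gammaE : gamma = gamma_ B C N%:R.
    rewrite /gamma /tau -expr2 sqrtr_sqr gtr0_norm// sigmaE /sigma_ /gamma_.
    by ring.
  have thetaE : theta = theta_ A B C N%:R (-1) rho by rewrite /theta_ mulN1r.
  split.
    by rewrite gammaE /gamma_; field; rewrite lt_eqF.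
  rewrite gammaE /tau sigmaE thetaE.
  have E_lt0 : B + C - N%:R < 0 by lra.
  apply: racah_transformable => //; rewrite -/s0 -/t1.
  + by move=> t; rewrite /= in_itv /= andbT.
  + move=> r r_gt i _; rewrite gt_eqF// ltr_wpDr//.
    suff : s0 <= r by rewrite /s0; lra.
    by case: r_gt => [->//|]; rewrite /= in_itv /= andbT => /ltW.
  + by rewrite sqrrN expr1n.
  + by rewrite mulN1r oppr_gt0.
  + by rewrite mulN1r oppr_gt0.
  + by move=> t; rewrite /= in_itv /= => /andP[].
  + by move=> t; rewrite /= in_itv /= => /andP[_ t1']; lra.
  + move=> t; rewrite /= in_itv /= => /andP[t_gt0 t_lt1].
    have d_gt0 : 0 < 1 + -1 * t by lra.
    rewrite in_itv /= andbT mobiusE ?sqrrN ?expr1n ?(gt_eqF d_gt0) ?(lt_eqF E1_lt0)//.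
    by rewrite ltrDl nmulr_rgt0// pmulr_llt0 ?invr_gt0// mulN1r oppr_lt0.
  + split; [exact: interval_open|exact: interval_is_interval|].
    by move=> t; rewrite /= in_itv /= => /andP[].
  + move=> r; rewrite /= in_itv /= andbT => r_gt.
    have t1r : t1 - r < 0 by move: r_gt; rewrite /t1 /s0; lra.
    split; first by rewrite lt_eqF.
    have rt1 : 0 < r - t1 by rewrite -opprB oppr_gt0.
    rewrite in_itv /= mulN1r -(opprB r t1) invrN mulrNN.
    apply/andP; split; first by rewrite divr_gt0// subr_gt0.
    rewrite ltr_pdivrMr// mul1r.
    by rewrite /t1 /s0; lra.
- move=> C_gt chain rho eta theta sigma tau gamma.
  set s0 := - (A + B); set t1 := C - A - N%:R.
  have E_gt0 : 0 < B + C - N%:R by lra.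
  have E1_gt0 : 0 < B + C - N%:R + 1 by lra.
  have K_gt0 : 0 < N%:R * (A + C) * (B + C) * (A - B + N%:R) * (B + C - N%:R + 1).
    by rewrite !mulr_gt0//; lra.
  have rho2 : rho ^+ 2 = 1 * (B + C - N%:R + 1)
      * (N%:R * (A + C) * (B + C) * (A - B + N%:R)).
    by rewrite sqr_sqrtr ?ltW//; ring.
  have rho_neq0 : rho != 0 by rewrite gt_eqF// sqrtr_gt0.
  have sigmaE : sigma = sigma_ B C N%:R 1 by rewrite /sigma /sigma_ mul1r.
  have sigma_gt0 : 0 < sigma by rewrite invr_gt0; lra.
  have gammaE : gamma = gamma_ B C N%:R.
    by rewrite /gamma /tau -expr2 sqrtr_sqr gtr0_norm.
  have thetaE : theta = theta_ A B C N%:R 1 rho by rewrite /theta_ mul1r.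
  split.
    by rewrite gammaE /gamma_; field; rewrite gt_eqF//; lra.
  rewrite gammaE /tau sigmaE thetaE.
  apply: racah_transformable => //; rewrite -/s0 -/t1.
  + by move=> t; rewrite /= in_itv /= => /andP[].
  + move=> r r_lt i iN; rewrite lt_eqF//.
    have rt1 : r < t1.
      case: r_lt => [->|]; first by rewrite /s0 /t1; lra.
      by rewrite /= in_itv /= => /andP[].
    have : i.+1%:R <= N%:R :> R by rewrite ler_nat.
    by move: rt1; rewrite /t1 -natr1; lra.
  + by rewrite expr1n.
  + by rewrite mul1r.
  + by rewrite mul1r; lra.
  + by move=> t; rewrite /= in_itv /= andbT.
  + by move=> t; rewrite /= in_itv /= andbT => t_gt0; lra.
  + move=> t; rewrite /= in_itv /= andbT => t_gt0.
    have d_gt0 : 0 < 1 + 1 * t by lra.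
    have d_neq0 : 1 + 1 * t != 0 by rewrite gt_eqF.
    rewrite in_itv /=; apply/andP; split.
      rewrite mobiusE ?expr1n ?(gt_eqF E1_gt0)//.
      rewrite ltrDl; apply: mulr_gt0 => //; apply: divr_gt0 => //.
      by rewrite mul1r.
    rewrite -subr_gt0 mobius_end_sub ?expr1n ?(gt_eqF E1_gt0)//.
    by rewrite divr_gt0.
  + split; [exact: interval_open|exact: interval_is_interval|].
    by move=> t; rewrite /= in_itv /= andbT.
  + move=> r; rewrite /= in_itv /= => /andP[r_gt r_lt].
    split; first by rewrite gt_eqF ?subr_gt0.
    by rewrite in_itv /= andbT mul1r divr_gt0 ?subr_gt0.
Qed.
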